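(* A set $A \subset \mathbb{D}([0,1];\mathbb{D})$ is relatively compact with respect to $d_{\mathbb{D}}$ if and only if it satisfies the following three conditions: (i) $\sup_{x \in A}\|x\|_{\mathbb{D}}<\infty$; (ii') (a) $\lim_{\delta \to 0} \sup_{x\in A}\sup_{t \in [0,1]} w''(x(t),\delta) =0$; (b) $\lim_{\delta \to 0} \sup_{x \in A} \sup_{t \in [0,1]} |x(t,\delta)-x(t,0)|=0$; (c) $\lim_{\delta \to 0} \sup_{x \in A} \sup_{t \in [0,1]} |x(t,1-)-x(t,1-\delta)|=0$; (iii') (a) $\lim_{\delta \to 0} \sup_{x\in A} w_{\mathbb{D}}''(x,\delta) =0$; (b) $\lim_{\delta \to 0} \sup_{x \in A} d_{J_1}^0(x(\delta),x(0))=0$; (c) $\lim_{\delta \to 0} \sup_{x \in A} d_{J_1}^0(x(1-),x(1-\delta))=0$.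
   Context: $\mathbb{D}$ is the set of functions $x:[0,1]\to\mathbb{R}$ that are right-continuous and have left limits, with $\|x\|=\sup_{s\in[0,1]}|x(s)|$. $\Lambda$ is the set of strictly increasing continuous functions from $[0,1]$ onto $[0,1]$, $e$ is the identity on $[0,1]$, and for $\lambda\in\Lambda$, $\|\lambda\|^0=\sup_{s<s'}\left|\log\frac{\lambda(s')-\lambda(s)}{s'-s}\right|$. The Skorohod $J_1$-topology on $\mathbb{D}$ is given by the (complete, separable) metric $d_{J_1}^0(x,y)=\inf_{\lambda\in\Lambda}\{\|\lambda\|^0\vee\|x-y\circ\lambda\|\}$. $\mathbb{D}([0,1];\mathbb{D})$ is the set of functions $x:[0,1]\to\mathbb{D}$ that are right-continuous at every $t\in[0,1)$ and have a left limit $x(t-)\in\mathbb{D}$ at every $t\in(0,1]$, both with respect to $d_{J_1}^0$. For $x\in\mathbb{D}([0,1];\mathbb{D})$, write $x(t,s)$ for the value of $x(t)\in\mathbb{D}$ at $s$, and $x(t,1-)=\lim_{s\uparrow 1}x(t,s)$. Put $\|x\|_{\mathbb{D}}=\sup_{t\in[0,1]}\|x(t)\|$. The space is equipped with the metric $d_{\mathbb{D}}(x,y)=\inf_{\lambda\in\Lambda}\{\|\lambda-e\|\vee\rho_{\mathbb{D}}(x,y\circ\lambda)\}$, where $\rho_{\mathbb{D}}(x,y)=\sup_{t\in[0,1]}d_{J_1}^0(x(t),y(t))$. For $\delta\in(0,1)$: for $x\in\mathbb{D}$, $w''(x,\delta)=\sup\{|x(s)-x(s_1)|\wedge|x(s_2)-x(s)|:\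 s_1\le s\le s_2,\ s_2-s_1\le\delta\}$; for $x\in\mathbb{D}([0,1];\mathbb{D})$, $w''_{\mathbb{D}}(x,\delta)=\sup\{d_{J_1}^0(x(t),x(t_1))\wedge d_{J_1}^0(x(t_2),x(t)):\ t_1\le t\le t_2,\ t_2-t_1\le\delta\}$ (all points in $[0,1]$). Relatively compact means having compact closure. *)

(* Defs.v *)
From HB Require Import structures.
From mathcomp Require Import all_boot all_order all_algebra.
From mathcomp Require Import all_classical all_reals all_analysis.
Set Implicit Arguments.
Unset Strict Implicit.
Unset Printing Implicit Defensive.
Import Order.TTheory GRing.Theory Num.Theory.
Import numFieldNormedType.Exports.
Local Open Scope classical_set_scope.
Local Open Scope ring_scope.

(* Norms, distances and moduli are suprema and infima of nonnegative
   quantities, taken in the extended reals; no finiteness is built in. *)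

(* [0, 1] with the order and the topology inherited from R. *)
Definition unit_itv (R : realType) : Type := {i01 R}.

HB.instance Definition _ (R : realType) :=
  Order.Total.copy (unit_itv R) {i01 R}.
HB.instance Definition _ (R : realType) :=
  Topological.copy (unit_itv R)
    (initial_topology (fun t : {i01 R} => t%:num : R)).

Definition uval (R : realType) (t : unit_itv R) : R := (t : {i01 R})%:num.
Definition u0 (R : realType) : unit_itv R := 0%:i01.
Definition u1 (R : realType) : unit_itv R := 1%:i01.
Definition uonem (R : realType) (t : unit_itv R) : unit_itv R :=
  (1 - (t : {i01 R})%:num)%:i01.
Arguments u0 {R}.
Arguments u1 {R}.

(* One-sided neighbourhoods within [0, 1]. *)
Definition at_lt (R : realType) (t : unit_itv R) : set_system (unit_itv R) :=
  within [set u | u < t] (nbhs t).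
Definition at_gt (R : realType) (t : unit_itv R) : set_system (unit_itv R) :=
  within [set u | t < u] (nbhs t).

Definition cadlag (R : realType) (T : topologicalType) (x : unit_itv R -> T) :=
  (forall t, t < u1 -> x u @[u --> at_gt t] --> x t) /\
  (forall t, u0 < t -> exists l : T, x u @[u --> at_lt t] --> l).

(* Value x(t-); meaningful when the left limit exists and is unique. *)
Definition left_lim (R : realType) (T : ptopologicalType) (x : unit_itv R -> T)
  (t : unit_itv R) : T := lim (x u @[u --> at_lt t]).

Lemma cadlag_cst (R : realType) (T : topologicalType) (a : T) :
  cadlag (fun _ : unit_itv R => a).
Proof. by split=> t _; [|exists a]; exact: cvg_cst. Qed.

Section metric_open.
Context {R : realType} {T : Type} (d : T -> T -> \bar R).

Definition metric_open (U : set T) :=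
  forall x, U x -> exists2 e : R, 0 < e & forall y, (d x y < e%:E)%E -> U y.

Lemma metric_openT : metric_open setT.
Proof. by move=> x _; exists 1. Qed.

Lemma metric_openI : setI_closed metric_open.
Proof.
move=> U V oU oV x [/oU[e e0 eU] /oV[f f0 fV]].
exists (Order.min e f); first by rewrite lt_min e0.
by move=> y; rewrite EFin_min lt_min => /andP[/eU ? /fV].
Qed.

Lemma metric_open_bigU (J : Type) (f : J -> set T) :
  (forall j, metric_open (f j)) -> metric_open (\bigcup_j f j).
Proof.
move=> of_ x [j _ /of_[e e0 ef]]; exists e => // y /ef fy.
by exists j.
Qed.
End metric_open.

(* Strictly increasing continuous functions from [0, 1] onto [0, 1]. *)
Definition Lambda (R : realType) : set (unit_itv R -> unit_itv R) :=
  [set l | [/\ forall s t, s < t -> l s < l t,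
               continuous l & forall t, exists s, l s = t]].

Section skorohod.
Context {R : realType}.
Local Notation I := (unit_itv R).
Local Open Scope ereal_scope.

Definition unorm (x : I -> R) : \bar R := ereal_sup (range (fun s => `|x s|%:E)).

Definition log_norm (l : I -> I) : \bar R :=
  ereal_sup [set `|ln ((uval (l p.2) - uval (l p.1)) /
                       (uval p.2 - uval p.1))|%:E
            | p in [set p : I * I | (p.1 < p.2)%R]].

(* Oscillation modulus w'' of a function into a space with distance d. *)
Definition modulus2 (T : Type) (d : T -> T -> \bar R) (x : I -> T) (delta : R) :=
  ereal_sup [set mine (d (x p.1.2) (x p.1.1)) (d (x p.2) (x p.1.2))
            | p in [set p : I * I * I |
                [/\ (p.1.1 <= p.1.2)%R, (p.1.2 <= p.2)%R &
                    (uval p.2 - uval p.1.1 <= delta)%R]]].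

Record D := MkD { Dfun :> I -> R ; _ : cadlag Dfun }.

HB.instance Definition _ := gen_eqMixin D.
HB.instance Definition _ := gen_choiceMixin D.
HB.instance Definition _ := isPointed.Build D (MkD (cadlag_cst R (0%R : R))).

Definition dJ1 (x y : D) : \bar R :=
  ereal_inf [set maxe (log_norm l) (unorm (fun s => x s - y (l s))%R)
            | l in @Lambda R].

HB.instance Definition _ := isOpenTopological.Build D
  (metric_openT dJ1) (@metric_openI _ _ dJ1) (@metric_open_bigU _ _ dJ1).

Record DD := MkDD { DDfun :> I -> D ; _ : cadlag DDfun }.

HB.instance Definition _ := gen_eqMixin DD.
HB.instance Definition _ := gen_choiceMixin DD.

Definition DDnorm (x : DD) : \bar R := ereal_sup (range (fun t => unorm (x t))).

Definition rhoDD (x y : I -> D) : \bar R :=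
  ereal_sup (range (fun t => dJ1 (x t) (y t))).

Definition dDD (x y : DD) : \bar R :=
  ereal_inf [set maxe (unorm (fun t => uval (l t) - uval t)%R) (rhoDD x (y \o l))
            | l in @Lambda R].

HB.instance Definition _ := isOpenTopological.Build DD
  (metric_openT dDD) (@metric_openI _ _ dDD) (@metric_open_bigU _ _ dDD).

Definition w2 (x : D) (delta : R) : \bar R :=
  modulus2 (fun a b : R => `|a - b|%:E) x delta.

Definition w2DD (x : DD) (delta : R) : \bar R := modulus2 dJ1 x delta.

(* Supremum in [0, +oo] of a family of nonnegative quantities, so that the
   supremum over the empty family is 0 (ereal_sup set0 is -oo). *)
Definition nnsup (T : Type) (A : set T) (F : T -> \bar R) : \bar R :=
  ereal_sup (0 |` F @` A).

End skorohod.
Arguments D : clear implicits.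
Arguments DD : clear implicits.

(* Main.v *)
Require Import Defs.
From mathcomp Require Import all_boot all_order all_algebra.
From mathcomp Require Import all_classical all_reals all_analysis.
From mathcomp Require Import lra.
Import Order.TTheory GRing.Theory Num.Theory.
Import numFieldNormedType.Exports.
Local Open Scope classical_set_scope.

(** Both distances of the statement have the form
    [skorohod N d x y = inf_l max (N l, sup_t d (x t, y (l t)))], where [l] runs
    over the time changes, [N] measures how far [l] is from the identity and [d]
    is a distance between values: [dJ1] takes [log_norm] and the usual distance
    of the line, [dDD] takes the uniform displacement [disp] and [dJ1].  Every
    step is therefore proved once, for functions with values in an arbitrary
    space [S] with a distance [d], and used for [S] the line and for [S] the
    space [D].  The three moduli of a function (oscillation [w2_le], left end
    [left_le], right end [right_le]) are handled as one condition,
    [equicadlag]: for every [e] there is a single [r] for the whole family.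
    Conditions (ii') and (iii') say that the family of all values [x t] and the
    family [A] itself are equicadlag ([equicadlagP]).

    Necessity.  A cadlag function satisfies each modulus condition for small
    [r], and so do, for a smaller [r], all functions near it, because a time
    change close to the identity moves every time by little
    ([near_small_w2], [near_small_left], [near_small_right]).  If a property of
    the values holds near every value, then it holds for all values of all
    functions near a given one, since those values stay near the values and
    left limits of the given function and [0, 1] is compact
    ([near_small_pointwise]).  Compactness of the closure of [A] makes [r]
    uniform over [A] ([near_small_compact]).

    Sufficiency.  Let the values of an equicadlag family lie in a totally
    bounded set.  On a fine grid [j / m] the oscillation condition forces each
    function to stay near [x (j / m)] up to one switching time, and near
    [x ((j + 1) / m)] after it; switching across a large increment cannot happen in
    two adjacent windows, so the switching times can be chosen at mutual distance
    at least [1 / (2 m)] ([skeleton_exists]).  Two functions with close switching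
    times and close values on the grid are close: the piecewise linear time change that
    matches the switching times has slopes close to 1 ([skeleton_close]).  There
    are finitely many data to control, so the family is totally bounded for
    [skorohod log_norm d] ([tbounded_skorohod]).  This gives total boundedness of
    the values in [dJ1], and then of [A] for [dDD0 = skorohod log_norm dJ1].

    The distance [dDD] is not complete, but [dDD0] is, because
    [skorohod log_norm d] is complete when [d] is: the time changes along a fast
    Cauchy sequence compose to a limit with controlled slopes
    ([skorohod_complete]).  Hence an ultrafilter containing [A] converges for
    [dDD0], so also for the weaker [dDD], and this suffices for the closure of [A]
    to be compact ([compact_closure_ultra]). *)

Set Implicit Arguments.
Unset Strict Implicit.

(** * The unit interval *)

Section unit_interval.
Local Open Scope ring_scope.
Context {R : realType}.
Local Notation I := (unit_itv R).
Implicit Types (s t : I) (r : R).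

Lemma uval_ge0 t : 0 <= uval t.
Proof. by rewrite /uval. Qed.

Lemma uval_le1 t : uval t <= 1.
Proof. by rewrite /uval. Qed.

Lemma uvalu0 : uval (@u0 R) = 0.
Proof. by []. Qed.

Lemma uvalu1 : uval (@u1 R) = 1.
Proof. by []. Qed.

Lemma uval_onem t : uval (uonem t) = 1 - uval t.
Proof. by []. Qed.

Lemma le_uval s t : (s <= t) = (uval s <= uval t).
Proof. by []. Qed.

Lemma lt_uval s t : (s < t) = (uval s < uval t).
Proof. by []. Qed.

Lemma uval_inj : injective (@uval R).
Proof. by move=> s t st; apply/val_inj. Qed.

Lemma uval_surj r : 0 <= r -> r <= 1 -> exists t : I, uval t = r.
Proof. by move=> r0 r1; exists (Itv01 r0 r1). Qed.

Lemma nbhs_unitP t (U : set I) : nbhs t U <->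
  exists2 e : R, 0 < e & forall s, `|uval t - uval s| <= e -> U s.
Proof.
split.
  move=> [_ [[B oB <-] Bt] BU].
  have /nbhs_ballP[e /= e0 eB] : nbhs (uval t) B by exact: open_nbhs_nbhs.
  exists (e / 2); first by rewrite divr_gt0.
  move=> s ts; apply: BU; apply: eB; rewrite /ball /=; apply: le_lt_trans ts _.
  by lra.
move=> [e e0 eU]; exists (@uval R @^-1` ball (uval t) e); split.
- by exists (ball (uval t) e) => //; exact: ball_open.
- exact: ballxx.
- by move=> s /ltW; exact: eU.
Qed.

(** An ultrafilter on the unit interval is pushed to R, where [0, 1] is compact;
    the limit there is the limit here, since the topology is the initial one. *)
Lemma unit_compact : compact [set: I].
Proof.
rewrite compact_ultra => F FU _.
have [|c [c01 cF]] := @segment_compact R 0 1 ((@uval R) @ F) _.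
  by apply: (@filterE _ F) => t; rewrite /= in_itv /= uval_ge0 uval_le1.
move: c01; rewrite /= in_itv => /andP[c0 c1].
have [t tc] := uval_surj c0 c1.
exists t; split=> // U /nbhs_unitP[e e0 eU].
have [//|FnU] := in_ultra_setVsetC U FU.
have [_ [[s ? <-]]] := cF (@uval R @` (~` U)) (ball c e)
   (filterS (@preimage_image _ _ _ _) FnU) (nbhsx_ballx c e e0).
by rewrite -tc => /ltW/eU.
Qed.

End unit_interval.

(** * Extended metrics *)

Section extended_metric.
Local Open Scope ring_scope.
Context {R : realType}.

(** Distances are extended reals and are only ever compared with real bounds;
    this replaces their arithmetic. *)
Lemma lee_fin_eps (x : \bar R) (a : R) :
  (forall e, 0 < e -> (x <= (a + e)%:E)%E) -> (x <= a%:E)%E.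
Proof. by move=> xa; apply/lee_addgt0Pr => e /xa; rewrite EFinD. Qed.

Lemma lte_fin_le (x : \bar R) (a : R) :
  (x < a%:E)%E -> exists2 b, b < a & (x <= b%:E)%E.
Proof.
case: x => [x||] //=.
  by rewrite lte_fin => xa; exists x.
by move=> _; exists (a - 1); rewrite ?leNye//; lra.
Qed.

Lemma le_lte_fin (x : \bar R) (a b : R) : (x <= a%:E)%E -> a < b -> (x < b%:E)%E.
Proof. by move=> xa ab; apply: le_lt_trans xa _; rewrite lte_fin. Qed.

Lemma lte_fin_bound (x : \bar R) : (x < +oo)%E ->
  exists2 M : R, 0 <= M & (x <= M%:E)%E.
Proof.
case: x => [x _|//|_]; last by exists 0; rewrite ?leNye.
by exists `|x|; rewrite ?lee_fin ?ler_norm.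
Qed.

Lemma ge_sup_range (T : Type) (f : T -> \bar R) (a : \bar R) :
  (ereal_sup (range f) <= a)%E <-> forall t, (f t <= a)%E.
Proof.
split=> [fa t|fa].
  by apply: le_trans fa; apply: ereal_sup_ubound; exists t.
by apply: ge_ereal_sup => _ [t _ <-].
Qed.

(** An extended pseudometric, described by the real bounds of its values, so that
    an infinite distance needs no separate treatment. *)
Record emetric (T : Type) (d : T -> T -> \bar R) : Prop := Emetric {
  emetric_refl : forall x, (d x x <= 0)%E ;
  emetric_sym : forall x y (a : R), (d x y <= a%:E)%E -> (d y x <= a%:E)%E ;
  emetric_tri : forall x y z (a b : R),
    (d x y <= a%:E)%E -> (d y z <= b%:E)%E -> (d x z <= (a + b)%:E)%E }.

Lemma emetric_comp (T U : Type) (d : T -> T -> \bar R) (f : U -> T) :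
  emetric d -> emetric (fun x y => d (f x) (f y)).
Proof.
by case=> dr ds dt; split=> [x|x y a|x y z a b]; [exact: dr|exact: ds|exact: dt].
Qed.

Definition metrizes (T : topologicalType) (d : T -> T -> \bar R) :=
  forall x (U : set T), nbhs x U <->
    exists2 e : R, 0 < e & forall y, (d x y <= e%:E)%E -> U y.

(** Balls are open by the triangle inequality. *)
Lemma metric_open_metrizes (T : topologicalType) (d : T -> T -> \bar R) :
  emetric d -> (forall U : set T, open U <-> metric_open d U) -> metrizes d.
Proof.
move=> dm od x U; split.
  rewrite nbhsE => -[B [/od oB Bx] BU]; have [e e0 eB] := oB _ Bx.
  exists (e / 2); first by rewrite divr_gt0.
  by move=> y xy; apply/BU/eB; apply: le_lte_fin xy _; lra.
move=> [e e0 eU]; rewrite nbhsE.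
exists [set y | (d x y < e%:E)%E]; last by move=> y /ltW/eU.
split; last by apply: le_lte_fin (emetric_refl dm x) _.
apply/od => y /lte_fin_le[a ae xy]; exists ((e - a) / 2); first by lra.
move=> z /ltW yz; apply: le_lte_fin (emetric_tri dm xy yz) _; lra.
Qed.

Definition dR (a b : R) : \bar R := `|a - b|%:E.

Lemma emetric_dR : emetric dR.
Proof.
split=> [x|x y a|x y z a b]; rewrite /dR.
- by rewrite subrr normr0.
- by rewrite distrC.
- by rewrite !lee_fin => xy yz; apply: le_trans (ler_distD y _ _) (lerD xy yz).
Qed.

Lemma metrizes_dR : metrizes dR.
Proof.
move=> x U; split=> [/nbhs_ballP[e /= e0 eU]|[e e0 eU]].
  exists (e / 2); first by rewrite divr_gt0.
  by move=> y; rewrite lee_fin => xy; apply: eU; rewrite /ball /=; lra.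
by apply/nbhs_ballP; exists e => //= y xy; apply: eU; rewrite lee_fin ltW.
Qed.

End extended_metric.

(** * Time changes and Skorohod distances *)

Section time_changes.
Local Open Scope ring_scope.
Context {R : realType}.
Local Notation I := (unit_itv R).
Local Notation Lam := (@Lambda R).
Implicit Types (s t : I) (l m : I -> I).

Lemma Lambda_lt l s t : Lam l -> (l s < l t) = (s < t).
Proof.
case=> lS _ _; case: (ltgtP s t) => [/lS //|/lS lts|->]; last by rewrite ltxx.
by apply/negbTE; rewrite -leNgt ltW.
Qed.

Lemma Lambda_le l s t : Lam l -> (l s <= l t) = (s <= t).
Proof. by move=> Ll; rewrite !leNgt Lambda_lt. Qed.

(** Continuity comes for free: the preimages of two points on either side of
    [l t] bound a neighbourhood of [t] by monotonicity. *)
Lemma LambdaP l : (forall s t, s < t -> l s < l t) ->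
  (forall t, exists s, l s = t) -> Lam l.
Proof.
move=> lS lsurj; split=> // t U /nbhs_unitP[e e0 eU].
have lle s s' : s <= s' -> l s <= l s'.
  by rewrite le_eqVlt => /orP[/eqP->//|/lS/ltW].
have lmono s s' : l s < l s' -> s < s'.
  by move=> ss; rewrite ltNge; apply/negP => /lle; rewrite leNgt ss.
(* radii [a] on the left and [b] on the right of [t], from preimages of the
   points at distance [e] from [l t] when these lie in [0, 1] *)
have [a [a0 La]] : exists a : R, 0 < a /\
    forall s, uval t - uval s <= a -> uval (l t) - uval (l s) <= e.
  have [h|h] := leP (uval (l t)) e.
    exists 1; split=> // s _; have := uval_ge0 (l s); lra.
  have [| |p lp] := @uval_surj _ (uval (l t) - e).
  - lra.
  - have := uval_le1 (l t); lra.
  have [q qp] := lsurj p.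
  have qt : q < t by apply: lmono; rewrite qp lt_uval lp; lra.
  exists (uval t - uval q); split; first by rewrite subr_gt0 -lt_uval.
  move=> s st; have : q <= s by rewrite le_uval; lra.
  by move/lle; rewrite qp le_uval lp; lra.
have [b [b0 Lb]] : exists a : R, 0 < a /\
    forall s, uval s - uval t <= a -> uval (l s) - uval (l t) <= e.
  have [h|h] := leP 1 (uval (l t) + e).
    exists 1; split=> // s _; have := uval_le1 (l s); lra.
  have [| |p lp] := @uval_surj _ (uval (l t) + e).
  - have := uval_ge0 (l t); lra.
  - lra.
  have [q qp] := lsurj p.
  have qt : t < q by apply: lmono; rewrite qp lt_uval lp; lra.
  exists (uval q - uval t); split; first by rewrite subr_gt0 -lt_uval.
  move=> s st; have : s <= q by rewrite le_uval; lra.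
  by move/lle; rewrite qp le_uval lp; lra.
apply/nbhs_unitP; exists (Num.min a b); first by rewrite lt_min a0.
move=> s; rewrite le_min => /andP[].
rewrite !ler_norml => /andP[sa1 sa2] /andP[sb1 sb2].
apply: eU; rewrite ler_norml; apply/andP; split.
  by have := Lb s; lra.
by have := La s; lra.
Qed.

Lemma Lambda_id : Lam id.
Proof. by apply: LambdaP => // t; exists t. Qed.

Lemma Lambda_comp l m : Lam l -> Lam m -> Lam (l \o m).
Proof.
move=> [lS _ ls] [mS _ ms]; apply: LambdaP => [s t /mS/lS//|t].
by have [s <-] := ls t; have [r <-] := ms s; exists r.
Qed.

Lemma Lambda_inv l : Lam l -> exists m, [/\ Lam m, cancel l m & cancel m l].
Proof.
move=> Ll; have [_ _ /choice[m ml]] := Ll.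
have lK : cancel l m.
  move=> t; apply/eqP; rewrite eq_le -(Lambda_le _ _ Ll) -(Lambda_le t _ Ll).
  by rewrite !ml lexx.
exists m; split=> //; apply: LambdaP => [s t st|t].
  by rewrite -(Lambda_lt _ _ Ll) !ml.
by exists (l t); rewrite lK.
Qed.

Lemma Lambda_u0 l : Lam l -> l u0 = u0.
Proof.
move=> Ll; have [_ _ /(_ u0)[s su0]] := Ll; apply/eqP.
rewrite eq_le -{2}su0 (Lambda_le _ _ Ll) !le_uval !uvalu0.
by rewrite !uval_ge0.
Qed.

Lemma Lambda_u1 l : Lam l -> l u1 = u1.
Proof.
move=> Ll; have [_ _ /(_ u1)[s su1]] := Ll; apply/eqP.
rewrite eq_le -{3}su1 (Lambda_le _ _ Ll) !le_uval !uvalu1.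
by rewrite !uval_le1.
Qed.

Definition disp l : \bar R := unorm (fun t => uval (l t) - uval t).

Lemma dispP l (a : R) :
  (disp l <= a%:E)%E <-> forall t, `|uval (l t) - uval t| <= a.
Proof.
by rewrite /disp /unorm ge_sup_range; split=> h t; have := h t; rewrite lee_fin.
Qed.

(** [slopes a l] is [log_norm l <= a] without logarithms: every difference
    quotient of [l] lies between [exp (- a)] and [exp a]. *)
Definition slopes (a : R) l := forall s t, s <= t ->
  expR (- a) * (uval t - uval s) <= uval (l t) - uval (l s)
    <= expR a * (uval t - uval s).

Lemma log_normP l (a : R) : Lam l -> (log_norm l <= a%:E)%E <-> slopes a l.
Proof.
move=> Ll.
have key s t : s < t -> (`|ln ((uval (l t) - uval (l s)) / (uval t - uval s))|
    <= a) = (expR (- a) * (uval t - uval s) <= uval (l t) - uval (l s)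
    <= expR a * (uval t - uval s)).
  move=> st; have st0 : 0 < uval t - uval s by rewrite subr_gt0 -lt_uval.
  have lst0 : 0 < uval (l t) - uval (l s).
    by rewrite subr_gt0 -lt_uval Lambda_lt.
  set q := _ / _; have q0 : 0 < q by rewrite divr_gt0.
  rewrite -[_ * _ <= _]ler_pdivlMr// -[X in _ && X]ler_pdivrMr//= -/q.
  by rewrite ler_norml -[in RHS](lnK q0) !ler_expR.
split=> [la s t|la].
  rewrite le_eqVlt => /orP[/eqP->|st]; first by rewrite !subrr !mulr0 lexx.
  rewrite -key// -lee_fin; apply: le_trans la; apply: ereal_sup_ubound.
  by exists (s, t).
by apply: ge_ereal_sup => _ [[s t] /= st <-]; rewrite lee_fin key// la// ltW.
Qed.

Lemma slopes_id : slopes 0 id.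
Proof. by move=> s t st; rewrite oppr0 expR0 mul1r lexx. Qed.

Lemma slopes_comp a b l m : Lam m -> slopes a l -> slopes b m ->
  slopes (a + b) (l \o m).
Proof.
move=> Lm la mb s t st; have mst : m s <= m t by rewrite Lambda_le.
have /andP[l1 l2] := la _ _ mst; have /andP[m1 m2] := mb _ _ st.
rewrite opprD !expRD -!mulrA; apply/andP; split.
  by apply: le_trans l1; rewrite ler_pM2l ?expR_gt0.
by apply: (le_trans l2); rewrite ler_pM2l ?expR_gt0.
Qed.

Lemma slopes_inv a l m : Lam l -> cancel m l -> slopes a l -> slopes a m.
Proof.
move=> Ll mK la s t st; have mst : m s <= m t by rewrite -(Lambda_le _ _ Ll) !mK.
have := la _ _ mst; rewrite !mK => /andP[l1 l2].
rewrite expRN in l1.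
apply/andP; split.
  by rewrite expRN ler_pdivrMl ?expR_gt0.
by rewrite -ler_pdivrMl ?expR_gt0.
Qed.

Lemma slopes_disp a l t : Lam l -> slopes a l ->
  `|uval (l t) - uval t| <= expR a - 1.
Proof.
move=> Ll la; have t0 : u0 <= t by rewrite le_uval uval_ge0.
have := la _ _ t0; rewrite (Lambda_u0 Ll) uvalu0 !subr0 => /andP[l1 l2].
have t1 := uval_le1 t; have t0' := uval_ge0 t.
have a0 : 1 + - a <= expR (- a) := expR_ge1Dx _.
have a1 : 1 + a <= expR a := expR_ge1Dx _.
have ea : 1 <= expR a.
  have := la u0 u1; rewrite (Lambda_u0 Ll) (Lambda_u1 Ll) uvalu0 uvalu1.
  by rewrite le_uval uvalu0 uvalu1 !subr0 !mulr1 ler01 => /(_ isT)/andP[].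
have h1 : 0 <= uval t * (expR a + expR (- a) - 2) by apply: mulr_ge0 => //; lra.
have h2 : 0 <= (1 - uval t) * (expR a - 1) by apply: mulr_ge0; lra.
rewrite ler_norml; apply/andP; split; lra.
Qed.

(** The properties of a length function on the group of time changes, which make
    the distance [skorohod N d] symmetric and triangular. *)
Record group_length (N : (I -> I) -> \bar R) : Prop := GroupLength {
  length_id : (N id <= 0)%E ;
  length_inv : forall l m (a : R), Lam l -> Lam m -> cancel m l ->
    (N l <= a%:E)%E -> (N m <= a%:E)%E ;
  length_comp : forall l m (a b : R), Lam l -> Lam m ->
    (N l <= a%:E)%E -> (N m <= b%:E)%E -> (N (l \o m) <= (a + b)%:E)%E }.

Lemma group_length_log_norm : group_length (@log_norm R).
Proof.
split=> [|l m a Ll Lm mK|l m a b Ll Lm].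
- exact/(log_normP _ Lambda_id)/slopes_id.
- by move=> /(log_normP _ Ll) la; apply/(log_normP _ Lm)/(slopes_inv Ll).
- move=> /(log_normP _ Ll) la /(log_normP _ Lm) mb.
  exact/(log_normP _ (Lambda_comp Ll Lm))/slopes_comp.
Qed.

Lemma group_length_disp : group_length disp.
Proof.
split=> [|l m a Ll Lm mK|l m a b Ll Lm].
- by apply/dispP => t; rewrite subrr normr0.
- by move=> /dispP la; apply/dispP => t; rewrite distrC -{1}[t]mK; exact: la.
- move=> /dispP la /dispP mb; apply/dispP => t.
  exact: le_trans (ler_distD (uval (m t)) _ _) (lerD (la _) (mb _)).
Qed.

Definition skorohod (N : (I -> I) -> \bar R) (S : Type) (d : S -> S -> \bar R)
    (x y : I -> S) : \bar R :=
  ereal_inf [set maxe (N l) (ereal_sup (range (fun t => d (x t) (y (l t)))))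
            | l in Lam].

Section skorohod.
Variables (N : (I -> I) -> \bar R) (S : Type) (d : S -> S -> \bar R).

Lemma skorohod_le (a : R) x y l : Lam l -> (N l <= a%:E)%E ->
  (forall t, (d (x t) (y (l t)) <= a%:E)%E) -> (skorohod N d x y <= a%:E)%E.
Proof.
move=> Ll Nl xy; apply: (@le_trans _ _ (maxe (N l)
  (ereal_sup (range (fun t => d (x t) (y (l t))))))).
  by apply: ereal_inf_lbound; exists l.
by rewrite ge_max Nl /=; apply/ge_sup_range.
Qed.

Lemma skorohod_lt (a : R) x y : (skorohod N d x y < a%:E)%E ->
  exists l, [/\ Lam l, (N l <= a%:E)%E &
    forall t, (d (x t) (y (l t)) <= a%:E)%E].
Proof.
move=> /ereal_inf_lt[_ [l Ll <-]]; rewrite gt_max => /andP[/ltW Nl /ltW dl].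
by exists l; split=> //; apply/ge_sup_range.
Qed.

Lemma emetric_skorohod : group_length N -> emetric d -> emetric (skorohod N d).
Proof.
move=> NN dm.
split=> [x|x y a xy|x y z a b xy yz].
- by apply: (skorohod_le Lambda_id (length_id NN)) => t; exact: emetric_refl.
- apply/lee_fin_eps => e e0.
  have [|l [Ll Nl dl]] := @skorohod_lt (a + e) x y.
    by apply: le_lte_fin xy _; lra.
  have [m [Lm lK mK]] := Lambda_inv Ll.
  apply: (@skorohod_le _ _ _ m) => //; first exact: (length_inv NN Ll Lm mK Nl).
  by move=> t; apply: (emetric_sym dm); rewrite -{2}[t]mK.
- apply/lee_fin_eps => e e0.
  have [|l [Ll Nl dl]] := @skorohod_lt (a + e / 2) x y.
    by apply: le_lte_fin xy _; lra.
  have [|m [Lm Nm dm']] := @skorohod_lt (b + e / 2) y z.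
    by apply: le_lte_fin yz _; lra.
  have -> : a + b + e = (b + e / 2) + (a + e / 2) by lra.
  apply: (@skorohod_le _ _ _ (m \o l)); first exact: Lambda_comp.
    exact: (length_comp NN).
  by move=> t; rewrite addrC; apply: (emetric_tri dm (dl t)).
Qed.

End skorohod.
End time_changes.

(** * Right-continuous functions with left limits *)

Section cadlag_functions.
Local Open Scope ring_scope.
Context {R : realType}.
Local Notation I := (unit_itv R).
Implicit Types (s t u : I).

Lemma right_point t (e : R) : t < u1 -> 0 < e ->
  exists2 u : I, t < u & uval u <= uval t + e.
Proof.
rewrite lt_uval uvalu1 => t1 e0.
have [||u ue] := @uval_surj R (Num.min (uval t + e) 1).
- by rewrite le_min ler01 addr_ge0 ?uval_ge0// ltW.
- by rewrite ge_min lexx orbT.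
exists u; last by rewrite ue ge_min lexx.
by rewrite lt_uval ue lt_min t1 andbT; lra.
Qed.

Lemma left_point t (e : R) : u0 < t -> 0 < e ->
  exists2 u : I, u < t & uval t - e <= uval u.
Proof.
rewrite lt_uval uvalu0 => t0 e0.
have [||u ue] := @uval_surj R (Num.max (uval t - e) 0).
- by rewrite le_max lexx orbT.
- by rewrite ge_max ler01 andbT; have := uval_le1 t; lra.
exists u; last by rewrite ue le_max lexx.
by rewrite lt_uval ue gt_max t0 andbT; lra.
Qed.

Section metric.
Variables (T : topologicalType) (d : T -> T -> \bar R).
Hypotheses (dm : emetric d) (dT : metrizes d).

Lemma cvg_at_gtP (x : I -> T) (y : T) t : t < u1 ->
  (x u @[u --> at_gt t] --> y) <->
  (forall e : R, 0 < e -> exists2 u, t < u &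
    forall s, t < s -> s < u -> (d y (x s) <= e%:E)%E).
Proof.
move=> t1; split=> [xy e e0|xy U /dT[e e0 eU]].
  have /xy : nbhs y [set z | (d y z <= e%:E)%E] by apply/dT; exists e.
  move=> /nbhs_unitP[a a0 ha]; have [u tu ua] := right_point t1 a0.
  exists u => // s ts su; apply: ha => //.
  rewrite distrC ger0_norm; last by rewrite subr_ge0 -le_uval ltW.
  by move: su; rewrite lt_uval; lra.
have [u tu xu] := xy e e0.
apply/nbhs_unitP; exists ((uval u - uval t) / 2).
  by rewrite divr_gt0// subr_gt0 -lt_uval.
move=> s stu /= ts; apply/eU/xu => //.
move: ts tu stu; rewrite distrC !lt_uval => ts tu; rewrite ger0_norm => [stu|]; lra.
Qed.

Lemma cvg_at_ltP (x : I -> T) (y : T) t : u0 < t ->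
  (x u @[u --> at_lt t] --> y) <->
  (forall e : R, 0 < e -> exists2 u, u < t &
    forall s, u < s -> s < t -> (d y (x s) <= e%:E)%E).
Proof.
move=> t1; split=> [xy e e0|xy U /dT[e e0 eU]].
  have /xy : nbhs y [set z | (d y z <= e%:E)%E] by apply/dT; exists e.
  move=> /nbhs_unitP[a a0 ha]; have [u tu ua] := left_point t1 a0.
  exists u => // s ts su; apply: ha => //.
  rewrite ger0_norm; last by rewrite subr_ge0 -le_uval ltW.
  by move: ts; rewrite lt_uval; lra.
have [u tu xu] := xy e e0.
apply/nbhs_unitP; exists ((uval t - uval u) / 2).
  by rewrite divr_gt0// subr_gt0 -lt_uval.
move=> s stu /= ts; apply/eU/xu => //.
move: ts tu stu; rewrite !lt_uval => ts tu; rewrite ger0_norm => [stu|]; lra.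
Qed.

Lemma cadlagP (x : I -> T) : cadlag x <->
  (forall t, t < u1 -> forall e : R, 0 < e -> exists2 u, t < u &
    forall s, t <= s -> s < u -> (d (x t) (x s) <= e%:E)%E) /\
  (forall t, u0 < t -> exists l, forall e : R, 0 < e -> exists2 u, u < t &
    forall s, u < s -> s < t -> (d l (x s) <= e%:E)%E).
Proof.
split=> -[xr xl]; split=> t t01.
- move=> e e0; have /(cvg_at_gtP _ _ t01)/(_ e e0)[u tu h] := xr t t01.
  exists u => // s; rewrite le_eqVlt => /orP[/eqP<- _|]; last exact: h.
  by apply: le_trans (emetric_refl dm _) _; rewrite lee_fin ltW.
- by have [l /(cvg_at_ltP _ _ t01)] := xl t t01; exists l.
- apply/(cvg_at_gtP _ _ t01) => e e0; have [u tu h] := xr t t01 e e0.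
  by exists u => // s /ltW ts; exact: h.
- by have [l ?] := xl t t01; exists l; apply/(cvg_at_ltP _ _ t01).
Qed.

End metric.

Lemma left_limP (T : ptopologicalType) (d : T -> T -> \bar R) (x : I -> T) t :
  metrizes d -> cadlag x -> u0 < t ->
  forall e : R, 0 < e -> exists2 u, u < t &
    forall s, u < s -> s < t -> (d (left_lim x t) (x s) <= e%:E)%E.
Proof.
move=> dT [_ xl] t0; apply/(cvg_at_ltP dT _ _ t0).
by have [l h] := xl t t0; exact: (cvgP _ h).
Qed.

Lemma cadlag_Lambda (T : topologicalType) (d : T -> T -> \bar R) (x : I -> T) l :
  emetric d -> metrizes d -> cadlag x -> @Lambda R l -> cadlag (x \o l).
Proof.
move=> dm dT /(cadlagP dm dT)[xr xl] Ll; apply/(cadlagP dm dT).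
have [_ _ lsurj] := Ll; split=> t t01.
- move=> e e0; have [|u + h] := xr (l t) _ e e0.
    by rewrite -(Lambda_u1 Ll) Lambda_lt.
  have [v vu] := lsurj u; rewrite -vu Lambda_lt// => tv.
  exists v => // s ts sv; apply: h; first by rewrite Lambda_le.
  by rewrite -vu Lambda_lt.
- have [|y h] := xl (l t); first by rewrite -(Lambda_u0 Ll) Lambda_lt.
  exists y => e /h[u + hu]; have [v vu] := lsurj u.
  rewrite -vu Lambda_lt// => tv; exists v => // s vs st.
  by apply: hu; rewrite -?vu Lambda_lt.
Qed.

End cadlag_functions.

(** * Properties valid near a function, for all small parameters *)

Section locally_uniform_properties.
Local Open Scope ring_scope.
Context {R : realType}.
Local Notation I := (unit_itv R).
Implicit Types (s t u : I).

(** The form of compactness used throughout: a radius found locally, and which may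
    be decreased, can be chosen once for the whole compact set. *)
Lemma compact_cover_mono (T : topologicalType) (d : T -> T -> \bar R)
    (K : set T) (P : R -> T -> Prop) : metrizes d -> compact K ->
  (forall r r' x, r' <= r -> P r x -> P r' x) ->
  (forall x, K x -> exists2 r, 0 < r & forall y, (d x y <= r%:E)%E -> P r y) ->
  exists2 r, 0 < r & forall x, K x -> P r x.
Proof.
move=> dT /compact_near_coveringP cK Pmono Ploc.
have [|r [r0 rP]] := @filter_ex _ (0 : R)^'+ _ _ (filterI (nbhs_right_gt 0)
    (cK _ (0 : R)^'+ P _ _)).
  move=> x /Ploc[r r0 rP].
  exists ([set y | (d x y <= r%:E)%E], [set r' | r' <= r]).
    by split=> /=; [apply/dT; exists r|exact: nbhs_right_le].
  by move=> [y r'] /= [xy r'r]; apply: Pmono r'r _; exact: rP.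
by exists r.
Qed.

Definition dI (s t : I) : \bar R := `|uval s - uval t|%:E.

Lemma metrizes_dI : metrizes dI.
Proof. by move=> t U; exact: nbhs_unitP. Qed.

(** At every point [x] of [C], the property [P e y] holds for all [y] in [C] near
    [x] and all small [e]. *)
Definition near_small (T : Type) (C : set T) (d : T -> T -> \bar R)
    (P : R -> T -> Prop) :=
  forall x, C x -> exists2 r, 0 < r &
    forall y, C y -> (d x y < r%:E)%E -> forall e, 0 < e -> e <= r -> P e y.

Lemma near_small_compact (T : topologicalType) (d : T -> T -> \bar R)
    (K : set T) (P : R -> T -> Prop) : metrizes d -> compact K ->
  near_small setT d P ->
  exists2 r, 0 < r & forall x, K x -> forall e, 0 < e -> e <= r -> P e x.
Proof.
move=> dT cK Pl.
apply: (compact_cover_mono dT cK (P := fun r x =>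
  forall e, 0 < e -> e <= r -> P e x)) => [r r' x rr' Pr e e0 er'|x Kx].
  by apply: Pr => //; exact: le_trans rr'.
have [r r0 rP] := Pl x Logic.I; exists (r / 2); first by rewrite divr_gt0.
move=> y xy e e0 er; apply: rP => //; last by lra.
by apply: le_lte_fin xy _; lra.
Qed.

Lemma near_small_and (T : Type) (C : set T) (d : T -> T -> \bar R)
    (P Q : R -> T -> Prop) : near_small C d P -> near_small C d Q ->
  near_small C d (fun r x => P r x /\ Q r x).
Proof.
move=> Pl Ql x Cx; have [p p0 pP] := Pl x Cx; have [q q0 qQ] := Ql x Cx.
exists (Num.min p q) => [|y Cy]; first by rewrite lt_min p0.
rewrite EFin_min lt_min => /andP[xp xq] e e0.
by rewrite le_min => /andP[ep eq]; split; [exact: pP|exact: qQ].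
Qed.

Lemma near_small_comp (T U : Type) (C : set T) (d : T -> T -> \bar R) (f : U -> T)
  (P : R -> T -> Prop) : (forall x, C (f x)) -> near_small C d P ->
  near_small setT (fun x y => d (f x) (f y)) (fun r x => P r (f x)).
Proof.
move=> fC Pl x _; have [r r0 rP] := Pl _ (fC x).
by exists r => // y _; exact: rP.
Qed.

Section metric_valued.
Variables (S : topologicalType) (d : S -> S -> \bar R).
Hypotheses (dm : emetric d) (dS : metrizes d).

(** One statement for all times, ends included: at time 0 the point [l] is
    arbitrary, because no time precedes it. *)
Lemma cadlag_two_sided (x : I -> S) t : cadlag x ->
  exists l, forall e, 0 < e -> exists r, [/\ 0 < r,
    forall s, s < t -> uval t - uval s <= r -> (d l (x s) <= e%:E)%E &
    forall s, t <= s -> uval s - uval t <= r -> (d (x t) (x s) <= e%:E)%E].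
Proof.
move=> /(cadlagP dm dS)[xr xl].
have [l lP] : exists l, forall e, 0 < e -> exists2 r, 0 < r &
    forall s, s < t -> uval t - uval s <= r -> (d l (x s) <= e%:E)%E.
  have [t0|t0] := leP t u0.
    by exists (x t) => e e0; exists 1 => // s /lt_le_trans/(_ t0);
      rewrite lt_uval uvalu0 ltNge uval_ge0.
  have [l lP] := xl t t0; exists l => e /lP[u]; rewrite lt_uval => ut h.
  exists ((uval t - uval u) / 2); first by lra.
  by move=> s st us; apply: h => //; rewrite lt_uval; lra.
exists l => e e0; have [r r0 rP] := lP e e0.
have [t1|t1] := leP u1 t.
  exists r; split=> // s ts _; suff -> : s = t.
    by apply: le_trans (emetric_refl dm _) _; rewrite lee_fin ltW.
  apply/eqP; rewrite eq_le ts andbT; apply: le_trans t1.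
  by rewrite le_uval uvalu1 uval_le1.
have [u] := xr t t1 e e0; rewrite lt_uval => tu h.
exists (Num.min r ((uval u - uval t) / 2)); split.
- by rewrite lt_min r0; lra.
- by move=> s st; rewrite le_min => /andP[sr _]; exact: rP.
- by move=> s ts; rewrite le_min => /andP[_ su]; apply: h => //; rewrite lt_uval; lra.
Qed.

(** The values of a function near [x] are near values of [x].  Around each time
    [t] the values of [x] are near the left limit [l] or near [x t], and the property
    holds around both; compactness of [0, 1] selects a common radius. *)
Lemma near_small_pointwise N (P : R -> S -> Prop) : near_small setT d P ->
  near_small (@cadlag R S) (skorohod N d) (fun e x => forall t, P e (x t)).
Proof.
move=> Pl x xc.
have [||r r0 rP] := compact_cover_mono metrizes_dI unit_compact
    (P := fun r t => forall z, (d (x t) z <= r%:E)%E ->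
      forall e, 0 < e -> e <= r -> P e z).
- move=> r r' t r'r h z xz e e0 er'; apply: h => //; last exact: le_trans r'r.
  by apply: le_trans xz _; rewrite lee_fin.
- move=> t _; have [l lP] := cadlag_two_sided t xc.
  have [r1 r10 h1] := Pl l Logic.I; have [r2 r20 h2] := Pl (x t) Logic.I.
  have [|r [r0 hl hr]] := lP (Num.min r1 r2 / 3).
    by rewrite divr_gt0// lt_min r10.
  have m1 : Num.min r1 r2 <= r1 by rewrite ge_min lexx.
  have m2 : Num.min r1 r2 <= r2 by rewrite ge_min lexx orbT.
  have m0 : 0 < Num.min r1 r2 by rewrite lt_min r10.
  exists (Num.min r (Num.min r1 r2 / 3)); first by rewrite lt_min r0; lra.
  set q := Num.min r _; have q1 : q <= r by rewrite ge_min lexx.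
  have q2 : q <= Num.min r1 r2 / 3 by rewrite ge_min lexx orbT.
  move=> s; rewrite lee_fin ler_norml => /andP[st1 st2] z sz e e0 eq.
  have {}sz : (d (x s) z <= (Num.min r1 r2 / 3)%:E)%E.
    by apply: le_trans sz _; rewrite lee_fin.
  have [st|ts] := ltP s t.
    apply: h1 => //; last by lra.
    by apply: le_lte_fin (emetric_tri dm (hl s st _) sz) _; lra.
  apply: h2 => //; last by lra.
  by apply: le_lte_fin (emetric_tri dm (hr s ts _) sz) _; lra.
exists r => // y yc /skorohod_lt[l [Ll _ xy]] e e0 er t.
have [_ _ /(_ t)[s <-]] := Ll; exact: (rP s Logic.I _ (xy s)).
Qed.

Definition w2_le (e r : R) (x : I -> S) := forall s1 s s2,
  s1 <= s -> s <= s2 -> uval s2 - uval s1 <= r ->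
  (d (x s) (x s1) <= e%:E)%E \/ (d (x s2) (x s) <= e%:E)%E.

Definition left_le (e r : R) (x : I -> S) := forall s,
  uval s <= r -> (d (x s) (x u0) <= e%:E)%E.

(** Stated through pairs of times before 1 and thus without the left limit at 1;
    [right_le_left_lim] recovers it. *)
Definition right_le (e r : R) (x : I -> S) := forall s s',
  s <= s' -> s' < u1 -> 1 - uval s <= r -> (d (x s') (x s) <= e%:E)%E.

(** Three close times lie near a common [t]; the middle one is on the same
    side of [t] as the first or as the last. *)
Lemma cadlag_w2 (x : I -> S) (e : R) : cadlag x -> 0 < e ->
  exists2 r, 0 < r & w2_le e r x.
Proof.
move=> xc e0.
have [||r r0 rP] := compact_cover_mono metrizes_dI unit_compact
    (P := fun r t => forall s s2, t <= s -> s <= s2 -> uval s2 - uval t <= r ->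
      (d (x s) (x t) <= e%:E)%E \/ (d (x s2) (x s) <= e%:E)%E).
- by move=> r r' t r'r h s s2 ts ss sr; apply: h => //; exact: le_trans r'r.
- move=> t _; have [l lP] := cadlag_two_sided t xc.
  have [|r [r0 hl hr]] := lP (e / 2); first by rewrite divr_gt0.
  exists (r / 2); first by rewrite divr_gt0.
  move=> s1; rewrite lee_fin ler_norml => /andP[st1 st2] s s2 s1s ss2 s12.
  have s1s' : uval s1 <= uval s := s1s; have ss2' : uval s <= uval s2 := ss2.
  rewrite (splitr e); have [st|ts] := ltP s t; [left|right].
    apply: (emetric_tri dm (emetric_sym dm (hl s st _)) (hl s1 _ _)).
    - lra.
    - exact: le_lt_trans st.
    - lra.
  apply: (emetric_tri dm (emetric_sym dm (hr s2 _ _)) (hr s _ _)) => //.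
  - exact: le_trans ts _.
  - lra.
  - lra.
by exists r => // s1 s s2 s1s; exact: rP.
Qed.

Lemma cadlag_left (x : I -> S) (e : R) : cadlag x -> 0 < e ->
  exists2 r, 0 < r & left_le e r x.
Proof.
move=> xc e0; have [l lP] := cadlag_two_sided u0 xc.
have [r [r0 _ hr]] := lP e e0; exists r => // s sr.
by apply: (emetric_sym dm); apply: hr; rewrite ?uvalu0 ?subr0// le_uval uval_ge0.
Qed.

Lemma cadlag_right (x : I -> S) (e : R) : cadlag x -> 0 < e ->
  exists2 r, 0 < r & right_le e r x.
Proof.
move=> xc e0; have [l lP] := cadlag_two_sided u1 xc.
have [|r [r0 hl _]] := lP (e / 2); first by rewrite divr_gt0.
exists r => // s s' ss' s'1 sr.
have ss'' : uval s <= uval s' := ss'.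
rewrite (splitr e); apply: (emetric_tri dm (emetric_sym dm (hl s' s'1 _))).
  by rewrite uvalu1; lra.
by apply: hl; rewrite ?uvalu1//; exact: le_lt_trans s'1.
Qed.

Section transfer.
Variable N : (I -> I) -> \bar R.
Hypothesis Ndisp : forall e : R, 0 < e -> exists2 r : R, 0 < r &
  forall l, @Lambda R l -> (N l <= r%:E)%E -> (disp l <= e%:E)%E.

(** The matching of [x] with a nearby [y], read from the times of [y]; the
    assumption on [N] turns its smallness into a small displacement of times. *)
Lemma skorohod_near (x : I -> S) (e : R) : 0 < e -> exists2 r, 0 < r &
  r <= e /\ forall y, (skorohod N d x y < r%:E)%E ->
    exists m, [/\ @Lambda R m, forall s, `|uval (m s) - uval s| <= e &
      forall s, (d (x (m s)) (y s) <= e%:E)%E].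
Proof.
move=> e0; have [r r0 rN] := Ndisp e0.
exists (Num.min r e); first by rewrite lt_min r0.
split; first by rewrite ge_min lexx orbT.
move=> y /skorohod_lt[l [Ll Nl xy]]; have [m [Lm lK mK]] := Lambda_inv Ll.
exists m; split=> // s.
  have /dispP/(_ (m s)) : (disp l <= e%:E)%E.
    by apply: rN => //; apply: le_trans Nl _; rewrite lee_fin ge_min lexx.
  by rewrite mK distrC.
rewrite -{2}[s]mK; apply: le_trans (xy _) _.
by rewrite lee_fin ge_min lexx orbT.
Qed.

Lemma near_small_w2 (e : R) : 0 < e -> near_small (@cadlag R S) (skorohod N d) (w2_le e).
Proof.
move=> e0 x xc; have e30 : 0 < e / 3 by rewrite divr_gt0.
have [r r0 xr] := cadlag_w2 xc e30.
have [|a a0 [a1 a2]] := skorohod_near x (e := Num.min (e / 3) (r / 3)).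
  by rewrite lt_min e30 divr_gt0.
exists a => // y yc /a2[m [Lm ms xy]] f f0 fa s1 s s2 s1s ss2 s12.
have b1 : Num.min (e / 3) (r / 3) <= e / 3 by rewrite ge_min lexx.
have b2 : Num.min (e / 3) (r / 3) <= r / 3 by rewrite ge_min lexx orbT.
have xy' t : (d (x (m t)) (y t) <= (e / 3)%:E)%E.
  by apply: le_trans (xy t) _; rewrite lee_fin.
have close t t' : (d (x (m t)) (x (m t')) <= (e / 3)%:E)%E ->
    (d (y t) (y t') <= e%:E)%E.
  move=> tt'; have -> : e = e / 3 + (e / 3 + e / 3) by lra.
  apply: (emetric_tri dm (emetric_sym dm (xy' t))).
  exact: (emetric_tri dm tt' (xy' t')).
have [||||] := xr (m s1) (m s) (m s2).
- by rewrite Lambda_le.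
- by rewrite Lambda_le.
- have := ms s1; have := ms s2; rewrite !ler_norml => /andP[_ +] /andP[+ _]; lra.
- by move/close; left.
- by move/close; right.
Qed.

Lemma near_small_left (e : R) : 0 < e -> near_small (@cadlag R S) (skorohod N d) (left_le e).
Proof.
move=> e0 x xc; have e30 : 0 < e / 3 by rewrite divr_gt0.
have [r r0 xr] := cadlag_left xc e30.
have [|a a0 [a1 a2]] := skorohod_near x (e := Num.min (e / 3) (r / 2)).
  by rewrite lt_min e30 divr_gt0.
exists a => // y yc /a2[m [Lm ms xy]] f f0 fa s sf.
have b1 : Num.min (e / 3) (r / 2) <= e / 3 by rewrite ge_min lexx.
have b2 : Num.min (e / 3) (r / 2) <= r / 2 by rewrite ge_min lexx orbT.
have xy' t : (d (x (m t)) (y t) <= (e / 3)%:E)%E.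
  by apply: le_trans (xy t) _; rewrite lee_fin.
have -> : e = e / 3 + (e / 3 + e / 3) by lra.
apply: (emetric_tri dm (emetric_sym dm (xy' s))).
apply: (emetric_tri dm _ (xy' u0)); rewrite (Lambda_u0 Lm); apply: xr.
by have := ms s; rewrite ler_norml => /andP[_ +]; lra.
Qed.

Lemma near_small_right (e : R) : 0 < e -> near_small (@cadlag R S) (skorohod N d) (right_le e).
Proof.
move=> e0 x xc; have e30 : 0 < e / 3 by rewrite divr_gt0.
have [r r0 xr] := cadlag_right xc e30.
have [|a a0 [a1 a2]] := skorohod_near x (e := Num.min (e / 3) (r / 2)).
  by rewrite lt_min e30 divr_gt0.
exists a => // y yc /a2[m [Lm ms xy]] f f0 fa s s' ss' s'1 sf.
have b1 : Num.min (e / 3) (r / 2) <= e / 3 by rewrite ge_min lexx.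
have b2 : Num.min (e / 3) (r / 2) <= r / 2 by rewrite ge_min lexx orbT.
have xy' t : (d (x (m t)) (y t) <= (e / 3)%:E)%E.
  by apply: le_trans (xy t) _; rewrite lee_fin.
have -> : e = e / 3 + (e / 3 + e / 3) by lra.
apply: (emetric_tri dm (emetric_sym dm (xy' s'))).
apply: (emetric_tri dm _ (xy' s)); apply: xr.
- by rewrite Lambda_le.
- by rewrite -(Lambda_u1 Lm) Lambda_lt.
- by have := ms s; rewrite ler_norml => /andP[+ _]; lra.
Qed.

End transfer.
End metric_valued.

Lemma log_norm_disp (e : R) : 0 < e -> exists2 r : R, 0 < r &
  forall l, @Lambda R l -> (log_norm l <= r%:E)%E -> (disp l <= e%:E)%E.
Proof.
move=> e0; have e1 : 0 < 1 + e by lra.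
exists (ln (1 + e)); first by rewrite ln_gt0//; lra.
move=> l Ll /(log_normP _ Ll) ls; apply/dispP => t.
by apply: le_trans (slopes_disp t Ll ls) _; rewrite lnK ?posrE//; lra.
Qed.

Lemma disp_disp (e : R) : 0 < e -> exists2 r : R, 0 < r &
  forall l, @Lambda R l -> (disp l <= r%:E)%E -> (disp l <= e%:E)%E.
Proof. by move=> e0; exists e. Qed.

Definition bounded_by (r y : R) := `|y| <= r^-1.

(** Boundedness in the shape of a property with a small parameter: the bound
    [r^-1] grows as [r] decreases. *)
Lemma near_small_bounded : near_small setT (@dR R) bounded_by.
Proof.
move=> y _; have y0 : 0 < 2 * (`|y| + 1) by have := normr_ge0 y; lra.
exists (2 * (`|y| + 1))^-1 => [|z _]; first by rewrite invr_gt0.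
rewrite lte_fin => yz e e0 er; rewrite /bounded_by.
have : 2 * (`|y| + 1) <= e^-1 by rewrite -[X in X <= _]invrK lef_pV2// posrE// invr_gt0.
apply: le_trans.
have : (2 * (`|y| + 1))^-1 <= 1 by rewrite invf_le1//; have := normr_ge0 y; lra.
have : `|z| <= `|y| + `|y - z|.
  by rewrite -{1}(subKr y z); exact: ler_normB.
have := normr_ge0 y; lra.
Qed.

End locally_uniform_properties.

(** * Completeness *)

Section geometric_sequences.
Local Open Scope ring_scope.
Context {R : realType}.

Lemma half_expr_gt0 n : 0 < (2^-1 : R) ^+ n.
Proof. by rewrite exprn_gt0// invr_gt0. Qed.

Lemma half_exprS n : (2^-1 : R) ^+ n.+1 = 2^-1 ^+ n / 2.
Proof. by rewrite exprSr. Qed.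

Lemma half_expr_small (e : R) : 0 < e ->
  exists N, forall n, (N <= n)%N -> (2^-1 : R) ^+ n <= e.
Proof.
move=> e0.
have : (2^-1 : R) ^+ n @[n --> \oo] --> (0 : R).
  by apply: cvg_expr; rewrite ger0_norm// invf_lt1 ?ltr1n.
move=> /cvgrPdist_le/(_ e e0)[N _ hN]; exists N => n /hN /=.
by rewrite sub0r normrN gtr0_norm// half_expr_gt0.
Qed.

(** Completeness, tested on fast Cauchy sequences and with the rate that they
    impose on the convergence. *)
Definition seq_complete (T : Type) (d : T -> T -> \bar R) :=
  forall u : nat -> T, (forall n, (d (u n) (u n.+1) <= (2^-1 ^+ n)%:E)%E) ->
  exists l, forall n, (d (u n) l <= (2 * 2^-1 ^+ n)%:E)%E.

Lemma seq_completeI (T : Type) (d : T -> T -> \bar R) : emetric d ->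
  (forall u : nat -> T, (forall n, (d (u n) (u n.+1) <= (2^-1 ^+ n)%:E)%E) ->
    exists l, forall e : R, 0 < e -> exists N, forall n, (N <= n)%N ->
      (d (u n) l <= e%:E)%E) ->
  seq_complete d.
Proof.
move=> dm dc u du; have [l lP] := dc u du; exists l => n.
have unk k : (d (u n) (u (n + k)%N) <=
    (2 * 2^-1 ^+ n - 2 * 2^-1 ^+ (n + k))%:E)%E.
  elim: k => [|k IH]; first by rewrite addn0 subrr; exact: emetric_refl.
  rewrite addnS; apply: le_trans (emetric_tri dm IH (du _)) _.
  by rewrite lee_fin half_exprS; lra.
apply/lee_fin_eps => e e0; have [N hN] := lP e e0.
apply: le_trans (emetric_tri dm (unk N) (hN _ (leq_addl _ _))) _.
by rewrite lee_fin; have := half_expr_gt0 (n + N); lra.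
Qed.

(** The sequences [u n - 2 * 2^-n] and [u n + 2 * 2^-n] are monotone and enclose
    the limit. *)
Lemma seq_complete_dR : seq_complete (@dR R).
Proof.
move=> u du.
have h0 n := half_expr_gt0 n; have hS n := half_exprS n.
have duS n : `|u n - u n.+1| <= 2^-1 ^+ n by have := du n; rewrite lee_fin.
pose a n := u n - 2 * 2^-1 ^+ n; pose b n := u n + 2 * 2^-1 ^+ n.
have aS n : a n <= a n.+1.
  by have := duS n; rewrite ler_norml /a hS => /andP[]; have := h0 n; lra.
have bS n : b n.+1 <= b n.
  by have := duS n; rewrite ler_norml /b hS => /andP[]; have := h0 n; lra.
have am n k : a n <= a (n + k)%N.
  by elim: k => [|k IH]; rewrite ?addn0// addnS; exact: le_trans (aS _).
have bm n k : b (n + k)%N <= b n.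
  by elim: k => [|k IH]; rewrite ?addn0// addnS; exact: le_trans (bS _) _.
have ab n m : a n <= b m.
  apply: le_trans (am n m) _; apply: le_trans (bm m n); rewrite [(m + n)%N]addnC.
  by rewrite /a /b; have := h0 (n + m)%N; lra.
have supa : has_sup (range a).
  by split; [exists (a 0%N), 0%N|exists (b 0%N) => _ [n _ <-]].
exists (sup (range a)) => n; rewrite /dR lee_fin ler_norml; apply/andP; split.
  have : sup (range a) <= b n by apply: ge_sup => //; [case: supa|move=> _ [m _ <-]].
  by rewrite /b; lra.
have : a n <= sup (range a) by apply: sup_upper_bound => //; exists n.
by rewrite /a; lra.
Qed.

End geometric_sequences.

Section completeness.
Local Open Scope ring_scope.
Context {R : realType}.
Local Notation I := (unit_itv R).
Local Notation Lam := (@Lambda R).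
Implicit Types (s t u : I).

(** The upper slope bound makes [f] continuous, hence onto; the lower one makes it
    strictly increasing.  Time changes are built from their formulas or as limits
    through this criterion. *)
Lemma Lambda_of_bounds (f : I -> R) (a b : R) : f u0 = 0 -> f u1 = 1 -> 0 < a ->
  (forall s t, s <= t ->
    a * (uval t - uval s) <= f t - f s <= b * (uval t - uval s)) ->
  exists2 l, Lam l & forall t, uval (l t) = f t.
Proof.
move=> f0 f1 a0 fab.
have u0le t : u0 <= t by rewrite le_uval uval_ge0.
have leu1 t : t <= u1 by rewrite le_uval uval_le1.
have b0 : 0 < b.
  have /andP[_] := fab _ _ (u0le u1).
  by rewrite f0 f1 uvalu0 uvalu1 !subr0 mulr1; lra.
have fle s t : s <= t -> f s <= f t.
  move=> st; have /andP[+ _] := fab _ _ st.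
  by have : 0 <= a * (uval t - uval s); [rewrite mulr_ge0 ?subr_ge0// ltW|lra].
have fI t : exists v : I, uval v = f t.
  by apply: uval_surj; [rewrite -f0|rewrite -f1]; exact: fle.
have /choice[l lf] := fI; exists l => //; apply: LambdaP => [s t st|v].
  rewrite lt_uval !lf; have /andP[+ _] := fab _ _ (ltW st).
  have : 0 < a * (uval t - uval s) by rewrite mulr_gt0// subr_gt0 -lt_uval.
  by lra.
pose E := [set uval t | t in [set t | f t <= uval v]].
have E0 : E 0 by exists u0; rewrite //= f0 uval_ge0.
have supE : has_sup E.
  by split; [exists 0|exists 1 => _ [t _ <-]; exact: uval_le1].
have [||p pE] := @uval_surj R (sup E).
- exact: sup_upper_bound.
- by apply: ge_sup => [|_ [t _ <-]]; [exists 0|exact: uval_le1].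
exists p; apply: uval_inj; rewrite lf; apply/eqP; rewrite eq_le; apply/andP; split.
- rewrite leNgt; apply/negP => vp.
  suff : sup E <= sup E - (f p - uval v) / b.
    have : 0 < (f p - uval v) / b by rewrite divr_gt0// subr_gt0.
    by lra.
  apply: ge_sup => [|_ [s /= fs <-]]; first by exists 0.
  have sp : s <= p by rewrite leNgt; apply/negP => /ltW/fle; lra.
  have /andP[_ h] := fab _ _ sp.
  have : (f p - uval v) / b <= uval p - uval s.
    by rewrite ler_pdivrMr// mulrC; lra.
  by rewrite pE; lra.
- rewrite leNgt; apply/negP => vp.
  have p1 : p < u1.
    rewrite lt_neqAle leu1 andbT; apply/eqP => pu1; move: vp; rewrite pu1 f1.
    by have := uval_le1 v; lra.
  have [|u pu ue] := right_point p1 (e := (uval v - f p) / b).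
    by rewrite divr_gt0// subr_gt0.
  have Eu : E (uval u).
    exists u => //=; have /andP[_ h] := fab _ _ (ltW pu).
    have : b * (uval u - uval p) <= uval v - f p.
      by rewrite mulrC -ler_pdivlMr//; lra.
    by lra.
  have := sup_upper_bound supE Eu; rewrite -pE.
  by move: pu; rewrite lt_uval; lra.
Qed.

Lemma expR_sub1_le (c : R) : 0 <= c -> c <= 2^-1 -> expR c - 1 <= 2 * c.
Proof.
move=> c0 c1.
have h : 1 - c <= (expR c)^-1 by rewrite -expRN; exact: expR_ge1Dx.
have : expR c <= (1 - c)^-1.
  by rewrite -[expR c]invrK lef_pV2// posrE ?invr_gt0 ?expR_gt0//; lra.
have : (1 - c)^-1 <= 1 + 2 * c.
  by rewrite -div1r ler_pdivrMr; nra.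
lra.
Qed.

Section metric_valued.
Variables (S : topologicalType) (d : S -> S -> \bar R).
Hypotheses (dm : emetric d) (dS : metrizes d) (dc : seq_complete d).

(** Right continuity passes to uniform limits.  The left limits at a time [t] of
    the functions [y n] form a fast Cauchy sequence, and its limit is the left limit
    of [z]; this is where completeness of the space of values enters. *)
Lemma cadlag_uniform (y : nat -> I -> S) (z : I -> S) :
  (forall n, cadlag (y n)) ->
  (forall n t, (d (y n t) (y n.+1 t) <= (2^-1 ^+ n)%:E)%E) ->
  (forall n t, (d (y n t) (z t) <= (2 * 2^-1 ^+ n)%:E)%E) -> cadlag z.
Proof.
move=> yc yy yz; apply/(cadlagP dm dS); split=> t t01.
  move=> e e0; have e8 : 0 < e / 8 by rewrite divr_gt0.
  have [n /(_ n (leqnn n)) ne] := half_expr_small e8.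
  have [yr _] := (cadlagP dm dS _).1 (yc n).
  have [u tu hu] := yr t t01 _ e8; exists u => // s ts su.
  apply: le_trans (emetric_tri dm (emetric_sym dm (yz n t))
    (emetric_tri dm (hu s ts su) (yz n s))) _.
  by rewrite lee_fin; lra.
have yl n := ((cadlagP dm dS _).1 (yc n)).2 t t01.
have /choice[l lP] := yl.
have [|l' ll'] := dc (u := l).
  move=> n; apply/lee_fin_eps => e e0; have e2 : 0 < e / 2 by rewrite divr_gt0.
  have [u ut hu] := lP n _ e2; have [v vt hv] := lP n.+1 _ e2.
  have [s us st] : exists2 s, Num.max (uval u) (uval v) < uval s & s < t.
    have : Num.max (uval u) (uval v) < uval t.
      by rewrite gt_max; apply/andP; split; rewrite -lt_uval.
    have : uval u <= Num.max (uval u) (uval v) by rewrite le_max lexx.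
    set m := Num.max _ _ => um mt; have := uval_ge0 u; have := uval_le1 t => t1 u0'.
    have [||s sE] := @uval_surj R ((m + uval t) / 2); [lra|lra|].
    by exists s; rewrite ?lt_uval sE; lra.
  move: us; rewrite gt_max -!lt_uval => /andP[us vs].
  apply: le_trans (emetric_tri dm (hu s us st)
    (emetric_tri dm (yy n s) (emetric_sym dm (hv s vs st)))) _.
  by rewrite lee_fin; lra.
exists l' => e e0; have e8 : 0 < e / 8 by rewrite divr_gt0.
have [n /(_ n (leqnn n)) ne] := half_expr_small e8.
have [u ut hu] := lP n _ e8; exists u => // s us st.
apply: le_trans (emetric_tri dm (emetric_sym dm (ll' n))
  (emetric_tri dm (hu s us st) (yz n s))) _.
by rewrite lee_fin; lra.
Qed.

(** Let [lam n] nearly match [x n] with [x n.+1], and let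
    [L n = lam (n-1) o ... o lam 0].  The functions [y n = x n o L n] converge
    uniformly to some [z], and [L n] converges uniformly to a time change [m]
    whose slopes relative to [L n] tend to 1.  Then [x n] is matched with
    [z o m^-1] by [m o (L n)^-1]. *)
Lemma skorohod_complete (x : nat -> I -> S) : (forall n, cadlag (x n)) ->
  (forall n, (skorohod (@log_norm R) d (x n) (x n.+1) <= (2^-1 ^+ n)%:E)%E) ->
  exists2 z, cadlag z & forall e : R, 0 < e -> exists N, forall n, (N <= n)%N ->
    (skorohod (@log_norm R) d (x n) z <= e%:E)%E.
Proof.
move=> xc xx; pose h n : R := 2^-1 ^+ n.
have h0 n : 0 < h n := half_expr_gt0 n.
have hS n : h n.+1 = h n / 2 := half_exprS n.
have h1 n : h n <= 1.
  by elim: n => [|n IH]; [rewrite /h expr0|rewrite hS; have := h0 n; lra].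
(* Starting at index 3 leaves room for strictly larger bounds, small enough for
   [expR_sub1_le]. *)
have /choice[lam lamP] : forall n, exists l, [/\ Lam l, slopes (h n / 4) l &
    forall t, (d (x (n + 3)%N t) (x (n.+1 + 3)%N (l t)) <= (h n / 4)%:E)%E].
  move=> n.
  have [|l [Ll Nl dl]] := @skorohod_lt R (@log_norm R) S d (h n / 4)
      (x (n + 3)%N) (x (n.+1 + 3)%N).
    apply: le_lte_fin (xx _) _; rewrite -/(h _) addn3 !hS.
    by have := h0 n; lra.
  by exists l; split=> //; apply/log_normP.
pose L n := iteri n (fun k l => lam k \o l) id.
have LS n t : L n.+1 t = lam n (L n t) by [].
have LL n : Lam (L n).
  elim: n => [|n IH]; first exact: Lambda_id.
  by have [Ll _ _] := lamP n; exact: Lambda_comp.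
have Lslopes n k s t : s <= t ->
    expR (- ((h n - h (n + k)%N) / 2)) * (uval (L n t) - uval (L n s)) <=
    uval (L (n + k)%N t) - uval (L (n + k)%N s) <=
    expR ((h n - h (n + k)%N) / 2) * (uval (L n t) - uval (L n s)).
  move=> st; elim: k => [|k /andP[IH1 IH2]].
    by rewrite addn0 subrr mul0r oppr0 expR0 mul1r lexx.
  have [_ /(_ (L (n + k)%N s) (L (n + k)%N t)) lk _] := lamP (n + k)%N.
  rewrite addnS !LS.
  have Lst : L (n + k)%N s <= L (n + k)%N t by rewrite (Lambda_le _ _ (LL _)).
  have /andP[lk1 lk2] := lk Lst.
  have -> : (h n - h (n + k).+1) / 2 = h (n + k)%N / 4 + (h n - h (n + k)%N) / 2.
    by rewrite hS; lra.
  rewrite opprD !expRD -!mulrA; apply/andP; split.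
    by apply: le_trans lk1; rewrite ler_pM2l ?expR_gt0.
  by apply: (le_trans lk2); rewrite ler_pM2l ?expR_gt0.
have /choice[M MP] : forall t, exists r : R,
    forall n, `|uval (L n t) - r| <= 2 * h n.
  move=> t; have [n|r rP] := @seq_complete_dR R (fun n => uval (L n t)).
    have [Ll ls _] := lamP n; rewrite /dR lee_fin LS distrC.
    apply: le_trans (slopes_disp (L n t) Ll ls) _.
    have := h0 n; have := h1 n => hn1 hn0.
    by apply: le_trans (expR_sub1_le _ _) _; rewrite -/(h n); lra.
  by exists r => n; have := rP n; rewrite lee_fin.
have Mslopes n s t : s <= t ->
    expR (- (h n / 2)) * (uval (L n t) - uval (L n s)) <= M t - M s <=
    expR (h n / 2) * (uval (L n t) - uval (L n s)).
  move=> st; have Lst : 0 <= uval (L n t) - uval (L n s).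
    by rewrite subr_ge0 -le_uval Lambda_le.
  suff key e : 0 < e ->
      expR (- (h n / 2)) * (uval (L n t) - uval (L n s)) <= M t - M s + e /\
      M t - M s <= expR (h n / 2) * (uval (L n t) - uval (L n s)) + e.
    by apply/andP; split; apply/ler_addgt0Pr => e /key[].
  move=> e0; have e4 : 0 < e / 4 by rewrite divr_gt0.
  have [N hN] := half_expr_small e4.
  have /andP[l1 l2] := Lslopes n N _ _ st.
  have hnN : h (n + N)%N <= e / 4 by apply: hN; exact: leq_addl.
  have := MP t (n + N)%N; have := MP s (n + N)%N.
  rewrite !ler_norml => /andP[ms1 ms2] /andP[mt1 mt2].
  have e1 : expR (- (h n / 2)) * (uval (L n t) - uval (L n s)) <=
      expR (- ((h n - h (n + N)%N) / 2)) * (uval (L n t) - uval (L n s)).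
    by rewrite ler_wpM2r// ler_expR; have := h0 (n + N)%N; lra.
  have e2 : expR ((h n - h (n + N)%N) / 2) * (uval (L n t) - uval (L n s)) <=
      expR (h n / 2) * (uval (L n t) - uval (L n s)).
    by rewrite ler_wpM2r// ler_expR; have := h0 (n + N)%N; lra.
  split; lra.
have Mfix t : (forall n, L n t = t) -> M t = uval t.
  move=> Lt; apply/eqP; rewrite -subr_eq0 -normr_le0 distrC.
  apply/ler_addgt0Pr => e e0; rewrite add0r.
  have e2 : 0 < e / 2 by rewrite divr_gt0.
  have [N /(_ N (leqnn N)) hN] := half_expr_small e2.
  by have := MP t N; rewrite Lt => MN; apply: le_trans MN _; rewrite /h; lra.
have [||||m Lm mM] := @Lambda_of_bounds M (expR (- (h 0%N / 2))) (expR (h 0%N / 2)).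
- by rewrite Mfix// => n; exact: Lambda_u0.
- by rewrite Mfix// => n; exact: Lambda_u1.
- exact: expR_gt0.
- by move=> s t st; exact: (Mslopes 0%N).
pose y n := x (n + 3)%N \o L n.
have yy n t : (d (y n t) (y n.+1 t) <= (h n)%:E)%E.
  have [_ _ dl] := lamP n; apply: le_trans (dl (L n t)) _.
  by rewrite lee_fin; have := h0 n; lra.
have /choice[z zP] : forall t, exists z, forall n, (d (y n t) z <= (2 * h n)%:E)%E.
  by move=> t; exact: dc.
have yc n : cadlag (y n) by exact: (cadlag_Lambda dm dS (xc _) (LL n)).
have zc : cadlag z by exact: (cadlag_uniform yc yy (fun n t => zP t n)).
have [w [Lw mK wK]] := Lambda_inv Lm.
exists (z \o w); first exact: (cadlag_Lambda dm dS).
move=> e e0; have e2 : 0 < e / 2 by rewrite divr_gt0.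
have [N hN] := half_expr_small e2; exists (N + 3)%N => n Nn.
have [k [kN ->]] : exists k, (N <= k)%N /\ n = (k + 3)%N.
  have n3 : (3 <= n)%N by apply: leq_trans Nn; exact: leq_addl.
  by exists (n - 3)%N; rewrite -(leq_add2r 3) subnK.
have he : h k <= e / 2 := hN k kN.
have [v [Lv LK vK]] := Lambda_inv (LL k).
apply: (@skorohod_le _ _ _ _ _ _ _ (m \o v)); first exact: Lambda_comp.
  apply/(log_normP _ (Lambda_comp Lm Lv)) => s t st /=.
  have vst : v s <= v t by rewrite Lambda_le.
  rewrite !mM; have := Mslopes k _ _ vst; rewrite !vK => /andP[l1 l2].
  have st' : 0 <= uval t - uval s by rewrite subr_ge0 -le_uval.
  apply/andP; split; [apply: le_trans l1|apply: (le_trans l2)];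
    by rewrite ler_wpM2r// ler_expR; have := h0 k; lra.
move=> t /=; rewrite mK -{1}[t]vK; apply: le_trans (zP (v t) k) _.
by rewrite lee_fin; lra.
Qed.

End metric_valued.

Lemma seq_complete_skorohod (X : Type) (S : topologicalType) (d : S -> S -> \bar R)
    (f : X -> I -> S) : emetric d -> metrizes d -> seq_complete d ->
  (forall x, cadlag (f x)) -> (forall y, cadlag y -> exists x, f x = y) ->
  seq_complete (fun x y => skorohod (@log_norm R) d (f x) (f y)).
Proof.
move=> dm dS dc fc fs.
apply: seq_completeI => [|u du].
  exact: (emetric_comp f (emetric_skorohod group_length_log_norm dm)).
have [z /fs[x <-] zP] := skorohod_complete dm dS dc (fun n => fc (u n)) du.
by exists x.
Qed.

End completeness.

(** * Total boundedness *)

Section total_boundedness.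
Local Open Scope ring_scope.
Context {R : realType}.
Local Notation I := (unit_itv R).
Local Notation Lam := (@Lambda R).
Implicit Types (s t u : I).

(** An ultrafilter [G] on the closure of [A] need not contain [A]; its
    fattenings [{y in A | y within e of U}], for [U] in [G], generate a filter on [A].  An
    ultrafilter above it converges by hypothesis, and [G] stays within every
    positive distance of it, so [G] has the same limit. *)
Lemma compact_closure_ultra (T : topologicalType) (d : T -> T -> \bar R)
    (A : set T) : emetric d -> metrizes d ->
  (forall F : set_system T, UltraFilter F -> F A -> exists p : T, F --> p) ->
  compact (closure A).
Proof.
move=> dm dT Acvg; rewrite compact_ultra => G GU GA.
pose fat (U : set T) (e : R) :=
  A `&` [set y | exists2 z, U z & (d z y <= e%:E)%E].
pose F0 := filter_from [set p : set T * R | G p.1 /\ 0 < p.2]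
  (fun p => fat p.1 p.2).
have PF0 : ProperFilter F0.
  apply: filter_from_proper.
    apply: filter_from_filter.
      by exists (setT, 1); split => //=; exact: filterT.
    move=> [U e] [V f] [/= GU' e0] [/= GV f0].
    exists (U `&` V, Num.min e f); first by split; [exact: filterI|rewrite /= lt_min e0].
    move=> y [Ay [z [Uz Vz]]]; rewrite EFin_min le_min => /andP[ze zf].
    by split; split=> //; exists z.
  move=> [U e] [/= GU' e0].
  have [z [Az Uz]] := filter_ex (filterI GA GU').
  have [y [Ay zy]] := Az [set y | (d z y <= e%:E)%E]
    (iffRL (dT _ _) (ex_intro2 _ _ e e0 (fun _ => id))).
  by exists y; split=> //; exists z.
have [F [FU F0F]] := ultraFilterLemma PF0.
have FA : F A.
  by apply: F0F; exists (setT, 1); [split => //=; exact: filterT|move=> y []].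
have [p Fp] := Acvg F FU FA; exists p; split.
  move=> U /Fp FUp; have [y [Ay Uy]] := filter_ex (filterI FA FUp).
  by exists y.
move=> U /dT[e e0 eU].
have [//|GnU] := in_ultra_setVsetC U GU.
have FnU : F (fat (~` U) (e / 2)).
  by apply: F0F; exists (~` U, e / 2) => //; split=> //=; rewrite divr_gt0.
have FB : F [set y | (d p y <= (e / 2)%:E)%E].
  by apply: Fp; apply/dT; exists (e / 2); rewrite ?divr_gt0.
have [y [[Ay [z Uz zy]] py]] := filter_ex (filterI FnU FB).
exfalso; apply: Uz; apply: eU.
by rewrite (splitr e); exact: (emetric_tri dm py (emetric_sym dm zy)).
Qed.

(** Total boundedness in the form every ultrafilter on [K] is Cauchy.  The
    ultrafilter lives on an arbitrary type mapped to [T], so that the same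
    ultrafilter on a space of functions can be tested on values at fixed times
    and on the real parameters of the functions. *)
Definition tbounded (T : Type) (d : T -> T -> \bar R) (K : set T) :=
  forall (X : Type) (F : set_system X) (f : X -> T), UltraFilter F ->
    F (f @^-1` K) -> forall e : R, 0 < e ->
    exists2 U, F U & forall x y, U x -> U y -> (d (f x) (f y) <= e%:E)%E.

Lemma tbounded_itv (M : R) : tbounded dR `[(- M), M].
Proof.
move=> X F f FU FM e e0.
have PfF : ProperFilter (f @ F) by exact: fmap_proper_filter.
have [c [_ cF]] := @segment_compact R (- M) M (f @ F) PfF FM.
pose U := f @^-1` [set y | `|c - y| <= e / 2].
have [FUU|FnU] := in_ultra_setVsetC U FU.
  exists U => // x y; rewrite /U /dR lee_fin /= distrC => cx cy.
  by rewrite (splitr e); exact: le_trans (ler_distD c _ _) (lerD _ _).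
have e20 : 0 < e / 2 by rewrite divr_gt0.
have [_ [[x nUx <-]]] := cF (f @` (~` U)) (ball c (e / 2))
   (filterS (@preimage_image _ _ _ _) FnU) (nbhsx_ballx c _ e20).
by move=> /ltW h; exfalso; exact: nUx.
Qed.

(** Small sets of the ultrafilter give centers of balls of radius [2^-(n+1)];
    two consecutive balls meet, so the centers form a fast Cauchy sequence. *)
Lemma tbounded_cvg (T : Type) (d : T -> T -> \bar R) (K : set T)
    (F : set_system T) : emetric d -> seq_complete d -> tbounded d K ->
  UltraFilter F -> F K -> exists p, forall e : R, 0 < e ->
    F [set y | (d p y <= e%:E)%E].
Proof.
move=> dm dc Kb FU FK.
have h0 n := half_expr_gt0 (R := R) n.
have /choice[u uP] : forall n, exists x, F [set y | (d x y <= (2^-1 ^+ n.+1)%:E)%E].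
  move=> n; have [U FU' hU] := Kb T F id FU FK _ (h0 n.+1).
  have [x Ux] := filter_ex FU'; exists x.
  by apply: filterS FU' => y; exact: hU.
have [|p pu] := dc u.
  move=> n; have [y [ny Sny]] := filter_ex (filterI (uP n) (uP n.+1)).
  apply: le_trans (emetric_tri dm ny (emetric_sym dm Sny)) _.
  by rewrite lee_fin !half_exprS; have := h0 n; lra.
exists p => e e0; have e3 : 0 < e / 3 by rewrite divr_gt0.
have [n /(_ n (leqnn n)) ne] := half_expr_small e3.
apply: filterS (uP n) => y uy.
apply: le_trans (emetric_tri dm (emetric_sym dm (pu n)) uy) _.
by rewrite lee_fin half_exprS; have := h0 n; lra.
Qed.


(** With slopes [b i] on the pieces, the time change is
    [f r = sum_i b i * len i r], where [len i r] is the length of the part of piece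
    [i] to the left of [r].  The lengths are monotone in [r] and add up to [r], so
    bounds on the [b i] are bounds on the slopes of [f]. *)
Lemma piecewise_linear (m : nat) (p q : nat -> I) (c : R) :
  p 0%N = u0 -> p m = u1 -> q 0%N = u0 -> q m = u1 ->
  (forall j, (j < m)%N -> p j < p j.+1) ->
  (forall j, (j < m)%N ->
    expR (- c) * (uval (p j.+1) - uval (p j)) <= uval (q j.+1) - uval (q j)
      <= expR c * (uval (p j.+1) - uval (p j))) ->
  exists l, [/\ Lam l, slopes c l & forall j, (j <= m)%N -> l (p j) = q j].
Proof.
move=> p0 pm q0 qm plt pq.
have ple i j : (i <= j)%N -> (j <= m)%N -> uval (p i) <= uval (p j).
  move=> /subnK <-; elim: (j - i)%N => [//|k IH]; rewrite addSn => km.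
  by apply: le_trans (IH (ltnW km)) _; apply/ltW/plt.
pose len i (r : R) := Num.min r (uval (p i.+1)) - Num.min r (uval (p i)).
pose b i := (uval (q i.+1) - uval (q i)) / (uval (p i.+1) - uval (p i)).
pose f (r : R) := \sum_(i < m) b i * len i r.
have bE (i : 'I_m) : expR (- c) <= b i <= expR c.
  have pi : 0 < uval (p i.+1) - uval (p i) by rewrite subr_gt0; exact: plt.
  by rewrite /b ler_pdivlMr// ler_pdivrMr//; exact: pq.
have lenle (i : 'I_m) r r' : r <= r' -> len i r <= len i r'.
  move=> rr'; have : uval (p i) <= uval (p i.+1) by apply: ple.
  rewrite /len !minEle; do 4 case: ifP => /=; lra.
have lensum t : \sum_(i < m) len i (uval t) = uval t.
  rewrite -(big_mkord xpredT (fun i => len i (uval t))) telescope_sumr//.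
  rewrite p0 pm uvalu0 uvalu1.
  by rewrite (min_idPl (uval_le1 t)) (min_idPr (uval_ge0 t)) subr0.
have fdiff s t : s <= t ->
    expR (- c) * (uval t - uval s) <= f (uval t) - f (uval s)
      <= expR c * (uval t - uval s).
  move=> st; have -> : uval t - uval s = \sum_(i < m) (len i (uval t) - len i (uval s)).
    by rewrite sumrB !lensum.
  rewrite /f -sumrB !mulr_sumr.
  apply/andP; split; apply: ler_sum => i _; have /andP[b1 b2] := bE i;
    by rewrite -mulrBr ler_wpM2r// subr_ge0 lenle.
have fp j : (j <= m)%N -> f (uval (p j)) = uval (q j).
  elim: j => [_|j IH jm].
    rewrite /f big1 ?p0 ?q0 ?uvalu0// => i _.
    by rewrite /len !(min_idPl _) ?uval_ge0// subrr mulr0.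
  apply/eqP; rewrite -subr_eq0; apply/eqP.
  have -> : f (uval (p j.+1)) - uval (q j.+1) =
     f (uval (p j.+1)) - f (uval (p j)) - (uval (q j.+1) - uval (q j)).
    by rewrite (IH (ltnW jm)); lra.
  rewrite /f -sumrB (bigD1 (Ordinal jm))//= big1 ?addr0 => [|i ij].
    have pj : 0 < uval (p j.+1) - uval (p j) by rewrite subr_gt0; exact: plt.
    have pj' : uval (p j) <= uval (p j.+1) by lra.
    rewrite -mulrBr /len minxx (min_idPr pj') (min_idPl pj') minxx subrr subr0.
    by rewrite /b divfK ?subrr// lt0r_neq0.
  rewrite -mulrBr.
  have ij' : nat_of_ord i != j by [].
  have [ij2|ji] := ltnP i j.
    have h1 := ple i.+1 j ij2 (ltnW jm); have h2 := ple i i.+1 (leqnSn _) (ltn_ord i).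
    have h3 := ple j j.+1 (leqnSn _) jm.
    rewrite /len !(min_idPr _) ?subrr ?mulr0//; lra.
  have ji' : (j < i)%N by rewrite ltn_neqAle eq_sym ij'.
  have h1 := ple j.+1 i ji' (ltnW (ltn_ord i)).
  have h2 := ple i i.+1 (leqnSn _) (ltn_ord i).
  have h3 := ple j j.+1 (leqnSn _) jm.
  rewrite /len !(min_idPl _) ?subrr ?mulr0//; lra.
have [||||l Ll lf] := @Lambda_of_bounds R (f \o @uval R) (expR (- c)) (expR c).
- by have := fp 0%N (leq0n m); rewrite p0 q0.
- by have := fp m (leqnn m); rewrite pm qm.
- exact: expR_gt0.
- exact: fdiff.
exists l; split=> // [s t st|j jm]; first by rewrite !lf; exact: fdiff.
by apply: uval_inj; rewrite lf /= fp.
Qed.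

Lemma locate_piece (m : nat) (p : nat -> I) t : p 0%N <= t -> t < p m ->
  exists j, [/\ (j < m)%N, p j <= t & t < p j.+1].
Proof.
move=> p0; elim: m => [|m IH]; first by rewrite ltNge p0.
have [tm _|mt tS] := ltP t (p m); last by exists m.
by have [j [jm h1 h2]] := IH tm; exists j; split=> //; exact: ltnW.
Qed.

Section metric_valued.
Variables (S : topologicalType) (d : S -> S -> \bar R).
Hypotheses (dm : emetric d) (dS : metrizes d).

(** By the oscillation condition each value on [[a, b]] is within [e] of [x a] or
    of [x b].  The switching time is the supremum of the times at which it is
    within [e] of [x a]; before it, a value is within [e] of [x a] or of a later value that is
    near [x a].  When [x a] and [x b] are close, any time will do, and the midpoint
    keeps it away from the neighbouring windows. *)
Lemma switching_time (x : I -> S) (e r : R) (a b : I) : cadlag x -> 0 < e ->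
  w2_le d e r x -> a < b -> uval b - uval a <= r ->
  exists c, [/\ a <= c, c <= b,
    forall t, a <= t -> t < c -> (d (x a) (x t) <= (2 * e)%:E)%E,
    forall t, c <= t -> t <= b -> (d (x b) (x t) <= (2 * e)%:E)%E &
    (d (x a) (x b) <= e%:E)%E -> uval c = (uval a + uval b) / 2].
Proof.
move=> /(cadlagP dm dS)[xr _] e0 xw ab bar.
have ab' : uval a < uval b := ab.
have two : 2 * e = e + e by lra.
have le2 y z : (d y z <= e%:E)%E -> (d y z <= (2 * e)%:E)%E.
  by move=> h; apply: le_trans h _; rewrite lee_fin; lra.
have [abe|abe] := pselect (d (x a) (x b) <= e%:E)%E.
  have xab t : a <= t -> t <= b -> (d (x t) (x a) <= e%:E)%E \/
      (d (x b) (x t) <= e%:E)%E by move=> at_ tb; exact: xw.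
  have [||c cE] := @uval_surj R ((uval a + uval b) / 2).
  - by have := uval_ge0 a; lra.
  - by have := uval_le1 b; lra.
  have ac : a <= c by rewrite le_uval cE; lra.
  have cb : c <= b by rewrite le_uval cE; lra.
  exists c; split=> // t h1 h2; rewrite two.
  - have [/(emetric_sym dm)/le2|h] := xab t h1 (le_trans (ltW h2) cb).
      by rewrite two.
    exact: (emetric_tri dm abe h).
  - have [h|/le2] := xab t (le_trans ac h1) h2; last by rewrite two.
    exact: (emetric_tri dm (emetric_sym dm abe) (emetric_sym dm h)).
pose E := [set uval t | t in [set t | [/\ a <= t, t <= b & (d (x a) (x t) <= e%:E)%E]]].
have Ea : E (uval a).
  exists a => //=; split=> //; first exact: ltW.
  by apply: le_trans (emetric_refl dm _) _; rewrite lee_fin ltW.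
have Eb : ubound E (uval b) by move=> _ [t [_ tb _] <-].
have supE : has_sup E by split; [exists (uval a)|exists (uval b)].
have aE : uval a <= sup E by exact: sup_upper_bound.
have bE : sup E <= uval b by apply: ge_sup => //; exists (uval a).
have [||c cE] := @uval_surj R (sup E).
- by have := uval_ge0 a; lra.
- by have := uval_le1 b; lra.
have after t : c < t -> t <= b -> (d (x b) (x t) <= e%:E)%E.
  move=> ct tb; have act : a <= t.
    by apply: le_trans (ltW ct); rewrite le_uval cE.
  have [/(emetric_sym dm) h|//] := xw a t b act tb bar.
  have : E (uval t) by exists t.
  move=> /(sup_upper_bound supE); rewrite -cE.
  by move: ct; rewrite lt_uval => ct; rewrite leNgt ct.
exists c; split=> // [||t at_ tc|t ct tb].
- by rewrite le_uval cE.
- by rewrite le_uval cE.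
- have : uval t < sup E by rewrite -cE -lt_uval.
  move=> /(sup_gt supE.1)[_ [s [as_ sb ds] <-]] ts.
  have [|/(emetric_sym dm)/le2//|h] := xw a t s at_ (ltW ts).
    by have sb' : uval s <= uval b := sb; lra.
  by rewrite two; exact: (emetric_tri dm ds h).
- have [ct'|] := ltP c t; first exact/le2/after.
  move=> tc; have {tc}-> : t = c by apply/eqP; rewrite eq_le tc ct.
  have [cb|bc] := ltP c b; last first.
    have -> : c = b by apply/eqP; rewrite eq_le bc le_uval cE bE.
    by apply: le_trans (emetric_refl dm _) _; rewrite lee_fin; lra.
  have [|u cu hu] := xr c _ e e0.
    by apply: lt_le_trans cb _; rewrite le_uval uval_le1.
  have [s [cs su sb]] : exists s, [/\ c < s, s < u & s < b].
    have : uval c < Num.min (uval u) (uval b) by rewrite lt_min -!lt_uval cu.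
    have := uval_ge0 c; have := uval_le1 u.
    have : Num.min (uval u) (uval b) <= uval u by rewrite ge_min lexx.
    have : Num.min (uval u) (uval b) <= uval b by rewrite ge_min lexx orbT.
    set w := Num.min _ _ => wb wu u1' c0 cw.
    have [||s sE] := @uval_surj R ((uval c + w) / 2); [lra|lra|].
    by exists s; rewrite !lt_uval sE; split; lra.
  rewrite two; apply: (emetric_tri dm (after s cs (ltW sb))).
  exact: (emetric_sym dm (hu s (ltW cs) su)).
Qed.

(** Piece [j] is represented by the value at the grid point [g j], which is the
    same for all functions of a family, while the points [p] depend on [x]. *)
Definition skeleton (e : R) (m : nat) (g : nat -> I) (x : I -> S)
    (p : nat -> I) :=
  [/\ p 0%N = u0, p m = u1,
      forall j, (j < m)%N -> (2 * m%:R)^-1 <= uval (p j.+1) - uval (p j) &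
      forall j t, (j < m)%N -> p j <= t -> t < p j.+1 ->
        (d (x (g j)) (x t) <= (2 * e)%:E)%E].

(** The inner points are the switching times of all windows but the last.  The
    left end condition makes the first window close, and the right end condition
    keeps [x] near [x (g (m-1))] on the last window until time 1. *)
Lemma skeleton_exists (e r : R) (m : nat) (g : nat -> I) (x : I -> S) :
  cadlag x -> 0 < e -> (0 < m)%N -> 2 / m%:R <= r ->
  (forall j, (j <= m)%N -> uval (g j) = j%:R / m%:R) ->
  w2_le d e r x -> left_le d e r x -> right_le d e r x ->
  exists p, skeleton e m g x p.
Proof.
move=> xc e0 m0 mr gE xw xl xr.
have m0' : 0 < (m%:R : R) by rewrite ltr0n.
pose h : R := m%:R^-1.
have h0 : 0 < h by rewrite invr_gt0.
have mh : m%:R * h = 1 by rewrite /h divff// lt0r_neq0.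
have {}mr : 2 * h <= r by [].
have gapE : (2 * m%:R)^-1 = h / 2 by rewrite invfM mulrC.
have {}gE j : (j <= m)%N -> uval (g j) = j%:R * h by exact: gE.
have gS j : (j < m)%N -> uval (g j.+1) = uval (g j) + h.
  by move=> jm; rewrite !gE// 1?ltnW// -natr1 mulrDl mul1r.
have /choice[c cP] : forall j, exists c, (j < m)%N -> [/\ g j <= c, c <= g j.+1,
    forall t, g j <= t -> t < c -> (d (x (g j)) (x t) <= (2 * e)%:E)%E,
    forall t, c <= t -> t <= g j.+1 -> (d (x (g j.+1)) (x t) <= (2 * e)%:E)%E &
    (d (x (g j)) (x (g j.+1)) <= e%:E)%E -> uval c = uval (g j) + h / 2].
  move=> j; have [jm|mj] := ltnP j m; last by exists u0.
  have [||c [c1 c2 c3 c4 c5]] := switching_time (a := g j) (b := g j.+1) xc e0 xw.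
  - by rewrite lt_uval gS//; lra.
  - by rewrite gS//; lra.
  exists c => _; split=> // /c5; rewrite gS// => ->; lra.
pose p j := if j is i.+1 then (if (i.+1 < m)%N then c i else u1) else u0.
have g0 : g 0%N = u0 by apply: uval_inj; rewrite gE// mul0r.
exists p; split.
- by [].
- by rewrite /p; case: m m0 {mr gE gS cP m0' mh h gapE h0 p} => // k _; rewrite ltnn.
- move=> j jm; rewrite gapE.
  have [jm1|] := ltnP j.+1 m; last first.
    move=> mj; have jE : j.+1 = m by apply/eqP; rewrite eqn_leq jm.
    rewrite /p ltnNge mj /=; case: j jm mj jE => [|j] jm mj jE.
      move: mh; rewrite -jE mul1r => h1.
      have := uvalu0 (R := R); have := uvalu1 (R := R); lra.
    have jm' : (j < m)%N by exact: ltnW.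
    rewrite /= jm; have [_ cg _ _ _] := cP j jm'.
    have cg' : uval (c j) <= uval (g j.+1) := cg.
    have := gS j.+1 jm; rewrite [uval (g j.+2)]gE// jE mh.
    have := uvalu1 (R := R); move: cg'; rewrite /=; lra.
  case: j jm jm1 => [|j] jm jm1.
    have [_ _ _ _ /(_ _)] := cP 0%N jm.
    rewrite /p jm1 uvalu0 => ->; first by rewrite g0 uvalu0; lra.
    rewrite g0; apply: (emetric_sym dm); apply: xl.
    by rewrite gS// g0 uvalu0; lra.
  rewrite /p jm1 jm.
  have jm' : (j < m)%N by exact: ltnW.
  have [a1 a2 _ _ a5] := cP j jm'; have [b1 b2 _ _ b5] := cP j.+1 jm.
  have a1' : uval (g j) <= uval (c j) := a1.
  have a2' : uval (c j) <= uval (g j.+1) := a2.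
  have b1' : uval (g j.+1) <= uval (c j.+1) := b1.
  have b2' : uval (c j.+1) <= uval (g j.+2) := b2.
  have gj := gS j jm'; have gjS := gS j.+1 jm.
  (* two adjacent windows cannot both be crossed by a large increment *)
  have [|||/(emetric_sym dm)/a5|/(emetric_sym dm)/b5] := xw (g j) (g j.+1) (g j.+2).
  - by rewrite le_uval gj; lra.
  - by rewrite le_uval gjS; lra.
  - by rewrite gjS gj; lra.
  - lra.
  - lra.
- move=> j t jm pt tp.
  have [tg|gt] := ltP t (g j).
    case: j jm pt tp tg => [|j] jm pt tp tg.
      by move: tg; rewrite g0 ltNge le_uval uval_ge0.
    have [_ _ _ h4 _] := cP j (ltnW jm); apply: h4; last exact: ltW.
    by move: pt; rewrite /p jm.
  have [jm1|mj] := ltnP j.+1 m.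
    have [_ _ h3 _ _] := cP j jm; apply: h3 => //.
    by move: tp; rewrite /p jm1.
  have jE : j.+1 = m by apply/eqP; rewrite eqn_leq jm.
  apply: le_trans (emetric_sym dm (xr (g j) t gt _ _)) _.
  - by move: tp; rewrite /p ltnNge mj.
  - by have := gS j jm; rewrite [uval (g j.+1)]gE// jE mh; lra.
  - by rewrite lee_fin; lra.
Qed.

(** Moving each partition point by a small fraction of the shortest piece changes
    the ratio of the lengths of corresponding pieces by a factor close to 1. *)
Lemma skeleton_close (e c : R) (m : nat) (g : nat -> I) (x y : I -> S)
    (p q : nat -> I) : 0 < c -> 0 < e -> (0 < m)%N -> g m = u1 ->
  skeleton e m g x p -> skeleton e m g y q ->
  (forall j, (j <= m)%N -> `|uval (p j) - uval (q j)| <=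
     Num.min (1 - expR (- c)) (expR c - 1) / (4 * m%:R)) ->
  (forall j, (j <= m)%N -> (d (x (g j)) (y (g j)) <= e%:E)%E) ->
  (skorohod (@log_norm R) d x y <= (Num.max c (5 * e))%:E)%E.
Proof.
move=> c0 e0 m0 gm [p0 pm pgap px] [q0 qm qgap qy] pq xy.
have m0' : 0 < (m%:R : R) by rewrite ltr0n.
have k1 : Num.min (1 - expR (- c)) (expR c - 1) <= 1 - expR (- c) by rewrite ge_min lexx.
have k2 : Num.min (1 - expR (- c)) (expR c - 1) <= expR c - 1 by rewrite ge_min lexx orbT.
have k0 : 0 <= Num.min (1 - expR (- c)) (expR c - 1).
  rewrite le_min !subr_ge0 -[X in expR (- c) <= X]expR0 -[X in X <= expR c]expR0.
  by rewrite !ler_expR; lra.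
move: (Num.min _ _) k0 k1 k2 pq => k k0 k1 k2 pq.
have gap0 : 0 < (2 * m%:R)^-1 :> R by rewrite invr_gt0; lra.
have kE : k / (4 * m%:R) = k * (2 * m%:R)^-1 / 2.
  by rewrite -mulrA; congr (_ * _); rewrite -invfM; congr (_^-1); lra.
(* Both ends of a piece move by at most [k / (4 m)], so its length changes by at
   most [k / (2 m)], which is at most [k] times the length. *)
have [|j jm|l [Ll lc lp]] := @piecewise_linear m p q c p0 pm q0 qm.
- by move=> j jm; rewrite lt_uval -subr_gt0; apply: lt_le_trans (pgap j jm).
- have := pq j (ltnW jm); have := pq j.+1 jm; rewrite kE !ler_norml.
  move=> /andP[a1 a2] /andP[b1 b2]; have := pgap j jm.
  move: (2 * m%:R)^-1 gap0 a1 a2 b1 b2 => w w0 a1 a2 b1 b2 gp.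
  have : k * w <= k * (uval (p j.+1) - uval (p j)) by rewrite ler_wpM2l.
  have gp0 : 0 <= uval (p j.+1) - uval (p j) by lra.
  have : k * (uval (p j.+1) - uval (p j)) <= (1 - expR (- c)) * (uval (p j.+1) - uval (p j)).
    by rewrite ler_wpM2r.
  have : k * (uval (p j.+1) - uval (p j)) <= (expR c - 1) * (uval (p j.+1) - uval (p j)).
    by rewrite ler_wpM2r.
  move=> h1 h2 h3; apply/andP; split; lra.
apply: (skorohod_le Ll).
  apply: (@le_trans _ _ c%:E); first exact/log_normP.
  by rewrite lee_fin le_max lexx.
move=> t; have [t1|t1] := ltP t u1; last first.
  have -> : t = u1 by apply/eqP; rewrite eq_le t1 le_uval uval_le1.
  rewrite (Lambda_u1 Ll) -gm; apply: le_trans (xy m (leqnn m)) _.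
  by rewrite lee_fin le_max; apply/orP; right; lra.
have [||j [jm pt tp]] := @locate_piece m p t; first by rewrite p0 le_uval uval_ge0.
  by rewrite pm.
have h1 := px j t jm pt tp.
have h2 : (d (y (g j)) (y (l t)) <= (2 * e)%:E)%E.
  apply: qy => //; first by rewrite -lp 1?ltnW// Lambda_le.
  by rewrite -lp// Lambda_lt.
apply: le_trans (emetric_tri dm (emetric_sym dm h1)
  (emetric_tri dm (xy j (ltnW jm)) h2)) _.
by rewrite lee_fin le_max; apply/orP; right; lra.
Qed.

(** An ultrafilter on the family is Cauchy because it is Cauchy for each of the
    finitely many data of a skeleton: the partition points in [0, 1] and the values
    at the grid points in [K]. *)
Lemma tbounded_skorohod (X : Type) (f : X -> I -> S) (A : set X) (K : set S) :
  (forall x, cadlag (f x)) -> tbounded d K ->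
  (forall x t, A x -> K (f x t)) ->
  (forall e, 0 < e -> exists2 r, 0 < r & forall x, A x ->
    [/\ w2_le d e r (f x), left_le d e r (f x) & right_le d e r (f x)]) ->
  tbounded (fun x y => skorohod (@log_norm R) d (f x) (f y)) A.
Proof.
move=> fc Kb fK fmod Y F h FU FA e e0.
(* Two values at matched times are compared through the grid point of their
   piece: 2 + 1 + 2 steps of size [e / 5]. *)
have e5 : 0 < e / 5 by rewrite divr_gt0.
have [r r0 rP] := fmod _ e5.
have [m [m0 mr]] : exists m, (0 < m)%N /\ 2 / m%:R <= r.
  have [n _ nr] : exists2 n : nat, True & 2 / r <= n%:R.
    by exists (Num.truncn (2 / r)).+1 => //; apply/ltW/truncnS_gt.
  exists n.+1; split=> //; rewrite ler_pdivrMr ?ltr0n// mulrC -ler_pdivrMr//.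
  by apply: le_trans nr _; rewrite ler_nat.
have /choice[g gE] : forall j, exists t : I, (j <= m)%N -> uval t = j%:R / m%:R.
  move=> j; have [jm|mj] := leqP j m; last by exists u0.
  have [||t tE] := @uval_surj R (j%:R / m%:R).
  - by rewrite divr_ge0.
  - by rewrite ler_pdivrMr ?ltr0n// mul1r ler_nat.
  by exists t.
have gm : g m = u1 by apply: uval_inj; rewrite gE// divff// pnatr_eq0 -lt0n.
have /choice[p pP] : forall y, exists p, A (h y) -> skeleton (e / 5) m g (f (h y)) p.
  move=> y; have [Ay|nAy] := pselect (A (h y)); last by exists (fun=> u0).
  have [w l r'] := rP _ Ay.
  by have [p pP] := skeleton_exists (fc _) e5 m0 mr gE w l r'; exists p.
pose k := Num.min (1 - expR (- e)) (expR e - 1) / (4 * m%:R).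
have k0 : 0 < k.
  rewrite divr_gt0 ?mulr_gt0 ?ltr0n// lt_min !subr_gt0.
  by rewrite expR_lt1 expR_gt1 e0 oppr_lt0 e0.
have /choice[U UP] : forall j, exists U, F U /\ forall y y', U y -> U y' ->
    `|uval (p y j) - uval (p y' j)| <= k.
  move=> j; have [|U FU' UP] := @tbounded_itv 1 Y F (fun y => uval (p y j)) FU _ k k0.
    apply: (@filterE _ F) => y /=; rewrite in_itv /= uval_le1 andbT.
    by apply: le_trans (uval_ge0 _); lra.
  by exists U; split.
have /choice[V VP] : forall j, exists V, F V /\ forall y y', V y -> V y' ->
    (d (f (h y) (g j)) (f (h y') (g j)) <= (e / 5)%:E)%E.
  move=> j; have [|V FV VP] := Kb Y F (fun y => f (h y) (g j)) FU _ _ e5.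
    by apply: filterS FA => y; exact: fK.
  by exists V; split.
exists [set y | A (h y) /\ forall j : 'I_m.+1, U j y /\ V j y].
  apply: filterI => //; apply: filter_forall => j.
  by apply: filterI; [exact: (UP j).1|exact: (VP j).1].
move=> y y' [Ay yP] [Ay' yP'].
have eE : Num.max e (5 * (e / 5)) = e by rewrite mulrC divfK// maxxx.
rewrite -[X in (_ <= X%:E)%E]eE.
apply: (skeleton_close e0 e5 m0 gm (pP y Ay) (pP y' Ay')) => j jm.
  by have [Uy _] := yP (Ordinal (jm : (j < m.+1)%N));
    have [Uy' _] := yP' (Ordinal (jm : (j < m.+1)%N)); exact: (UP j).2.
by have [_ Vy] := yP (Ordinal (jm : (j < m.+1)%N));
  have [_ Vy'] := yP' (Ordinal (jm : (j < m.+1)%N)); exact: (VP j).2.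
Qed.

End metric_valued.
End total_boundedness.

(** * The moduli of a family, as limits *)

Section suprema_of_nonnegative_families.
Local Open Scope ring_scope.
Context {R : realType}.
Local Notation I := (unit_itv R).

Lemma nnsup_ge0 (T : Type) (A : set T) (F : T -> \bar R) : (0 <= nnsup A F)%E.
Proof. by apply: ereal_sup_ubound; left. Qed.

Lemma nnsup_le (T : Type) (A : set T) (F : T -> \bar R) (a : \bar R) :
  (0 <= a)%E -> (nnsup A F <= a)%E <-> forall x, A x -> (F x <= a)%E.
Proof.
move=> a0; split=> [Fa x Ax|Fa].
  by apply: le_trans Fa; apply: ereal_sup_ubound; right; exists x.
by apply: ge_ereal_sup => _ [->//|[x Ax <-]]; exact: Fa.
Qed.

(** Nested suprema over functions and times are suprema over pairs, so that the
    conditions on the values [x t] become conditions on one indexed family. *)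
Lemma nnsup_setX (T U : Type) (A : set T) (F : T -> U -> \bar R) :
  nnsup A (fun x => nnsup setT (F x)) =
  nnsup (A `*` setT) (fun p => F p.1 p.2).
Proof.
apply/eqP; rewrite eq_le; apply/andP; split; apply/nnsup_le.
- exact: nnsup_ge0.
- move=> x Ax; apply/nnsup_le => [|u _]; first exact: nnsup_ge0.
  by apply: ereal_sup_ubound; right; exists (x, u).
- exact: nnsup_ge0.
- move=> [x u] [Ax _] /=; apply: (@le_trans _ _ (nnsup setT (F x))).
    by apply: ereal_sup_ubound; right; exists u.
  by apply: ereal_sup_ubound; right; exists x.
Qed.

Lemma cvg_nnsup_setX (T U : Type) (A : set T) (F : I -> T -> U -> \bar R)
    (G : set_system I) (a : \bar R) :
  (nnsup A (fun x => nnsup setT (F t x)) @[t --> G] --> a) =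
  (nnsup (A `*` setT) (fun p => F t p.1 p.2) @[t --> G] --> a).
Proof.
by congr (fmap _ G `=>` _); apply/funext => t; exact: nnsup_setX.
Qed.

Lemma cvg_u0_nneg (G : I -> \bar R) : (forall t, (0 <= G t)%E) ->
  (G t @[t --> (@u0 R)^'] --> 0%E) <->
  forall e : R, 0 < e -> exists2 r : R, 0 < r &
    forall t : I, u0 < t -> uval t <= r -> (G t <= e%:E)%E.
Proof.
move=> G0; split=> [Gc e e0|Gc U U0].
  have /Gc : nbhs (0%E : \bar R) [set y | (y <= e%:E)%E].
    rewrite /nbhs /= /ereal_nbhs /=; apply/nbhs_ballP; exists e => //= y.
    by rewrite /ball /= sub0r normrN lee_fin => /ltW; apply: le_trans; exact: ler_norm.
  move=> /nbhs_unitP[r r0 rP]; exists r => // t t0 tr; apply: rP.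
    by rewrite uvalu0 sub0r normrN ger0_norm ?uval_ge0.
  by rewrite /= gt_eqF.
have [e /= e0 eU] : exists2 e : R, 0 < e & forall y : R, `|y| < e -> U y%:E.
  move: U0; rewrite /nbhs /= /ereal_nbhs /= => /nbhs_ballP[e e0 eU].
  by exists e => // y ye; apply: eU; rewrite /ball /= sub0r normrN.
have [|r r0 rP] := Gc (e / 2); first by rewrite divr_gt0.
apply/nbhs_unitP; exists r => // t; rewrite uvalu0 sub0r normrN ger0_norm ?uval_ge0// => tr t0.
have {}t0 : u0 < t by rewrite lt_neqAle eq_sym t0 le_uval uval_ge0.
suff key y : (0 <= y)%E -> (y <= (e / 2)%:E)%E -> U y by apply: key (rP t t0 tr).
case: y => [y| |] //; rewrite !lee_fin => y0 ye.
by apply: eU; rewrite ger0_norm//; lra.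
Qed.

End suprema_of_nonnegative_families.

Section equicadlag_families.
Local Open Scope ring_scope.
Context {R : realType}.
Local Notation I := (unit_itv R).
Implicit Types (s t u : I).

Lemma uonemK t : uonem (uonem t) = t.
Proof. by apply: uval_inj; rewrite !uval_onem subKr. Qed.

Lemma uonem_lt1 t : (uonem t < u1) = (u0 < t).
Proof. by rewrite !lt_uval uval_onem uvalu0 uvalu1; apply/idP/idP; lra. Qed.

Lemma uonem_gt0 t : (u0 < uonem t) = (t < u1).
Proof. by rewrite -[in RHS](uonemK t) uonem_lt1. Qed.

Variables (S : ptopologicalType) (d : S -> S -> \bar R).
Hypotheses (dm : emetric d) (dS : metrizes d).

Lemma modulus2_le (x : I -> S) (e r : R) :
  (modulus2 d x r <= e%:E)%E <-> w2_le d e r x.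
Proof.
split=> [xe s1 s s2 h1 h2 h3|xw].
  apply/orP; rewrite -ge_min; apply: le_trans xe; apply: ereal_sup_ubound.
  by exists (s1, s, s2).
apply: ge_ereal_sup => _ [[[s1 s] s2] /= [h1 h2 h3] <-].
by rewrite ge_min; apply/orP; exact: xw.
Qed.

Lemma w2_le_mono (x : I -> S) (e r r' : R) : r' <= r ->
  w2_le d e r x -> w2_le d e r' x.
Proof. by move=> rr xw s1 s s2 h1 h2 h3; apply: xw => //; exact: le_trans rr. Qed.

Lemma right_le_left_lim (x : I -> S) (e r : R) s : cadlag x ->
  right_le d e r x -> s < u1 -> 1 - uval s <= r ->
  (d (left_lim x u1) (x s) <= e%:E)%E.
Proof.
move=> xc xr s1 sr; apply/lee_fin_eps => f f0.
have u01 : (u0 : I) < u1 by rewrite lt_uval uvalu0 uvalu1.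
have [u uu1 hu] := left_limP dS xc u01 f0.
have [s' [us' ss' s'1]] : exists s', [/\ u < s', s <= s' & s' < u1].
  have : Num.max (uval u) (uval s) < 1 by rewrite gt_max -[1]/(uval u1) -!lt_uval uu1.
  have : uval u <= Num.max (uval u) (uval s) by rewrite le_max lexx.
  have : uval s <= Num.max (uval u) (uval s) by rewrite le_max lexx orbT.
  set w := Num.max _ _ => sw uw w1; have := uval_ge0 s => s0.
  have [||s' sE] := @uval_surj R ((w + 1) / 2); [lra|lra|].
  by exists s'; rewrite !lt_uval le_uval sE uvalu1; split; lra.
rewrite addrC; apply: (emetric_tri dm (hu s' us' s'1)); exact: xr.
Qed.

Definition equicadlag (X : Type) (A : set X) (f : X -> I -> S) :=
  forall e, 0 < e -> exists2 r, 0 < r & forall x, A x ->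
    [/\ w2_le d e r (f x), left_le d e r (f x) & right_le d e r (f x)].

(** The right end condition controls [x] near its left limit at 1, so it bounds
    differences of values before 1, and conversely by passing to the limit. *)
Lemma equicadlagP (X : Type) (A : set X) (f : X -> I -> S) :
  (forall x, cadlag (f x)) -> equicadlag A f <->
  [/\ nnsup A (fun x => modulus2 d (f x) (uval t)) @[t --> (@u0 R)^'] --> 0%E,
      nnsup A (fun x => d (f x t) (f x u0)) @[t --> (@u0 R)^'] --> 0%E &
      nnsup A (fun x => d (left_lim (f x) u1) (f x (uonem t)))
        @[t --> (@u0 R)^'] --> 0%E].
Proof.
move=> fc; split=> [fe|[fw fl fr] e e0].
  split; apply/cvg_u0_nneg => [t|e e0]; try exact: nnsup_ge0;
    have [r r0 rP] := fe e e0; exists r => // t t0 tr;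
    (apply/nnsup_le; first by rewrite lee_fin ltW) => x /rP[xw xl xr].
  - exact/modulus2_le/(w2_le_mono tr).
  - exact: xl.
  - by apply: (right_le_left_lim (fc x) xr); rewrite ?uonem_lt1// uval_onem subKr.
have e2 : 0 < e / 2 by rewrite divr_gt0.
have [r1 r10 h1] := (cvg_u0_nneg (fun t => nnsup_ge0 _ _)).1 fw _ e0.
have [r2 r20 h2] := (cvg_u0_nneg (fun t => nnsup_ge0 _ _)).1 fl _ e0.
have [r3 r30 h3] := (cvg_u0_nneg (fun t => nnsup_ge0 _ _)).1 fr _ e2.
have e0' : (0 <= e%:E)%E by rewrite lee_fin ltW.
have e2' : (0 <= (e / 2)%:E)%E by rewrite lee_fin ltW.
pose r := Num.min (Num.min r1 1) (Num.min r2 r3).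
have r0 : 0 < r by rewrite !lt_min r10 r20 r30 ltr01.
have rr1 : r <= r1 by rewrite !ge_min lexx.
have r1' : r <= 1 by rewrite !ge_min lexx !orbT.
have rr2 : r <= r2 by rewrite !ge_min lexx !orbT.
have rr3 : r <= r3 by rewrite !ge_min lexx !orbT.
exists r => // x Ax; split.
- have [|u uE] := uval_surj _ r1'; first exact: ltW.
  apply/modulus2_le; rewrite -uE; apply: ((nnsup_le _ _ e0').1 (h1 u _ _) x Ax).
    by rewrite lt_uval uE.
  by rewrite uE.
- move=> s sr; have [s0|s0] := leP s u0.
    have -> : s = u0 by apply/eqP; rewrite eq_le s0 le_uval uval_ge0.
    by apply: le_trans (emetric_refl dm _) _.
  by apply: ((nnsup_le _ _ e0').1 (h2 s s0 _) x Ax); exact: le_trans rr2.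
- have near1 s : s < u1 -> 1 - uval s <= r ->
      (d (left_lim (f x) u1) (f x s) <= (e / 2)%:E)%E.
    move=> s1 sr; rewrite -[s]uonemK.
    apply: ((nnsup_le _ _ e2').1 (h3 (uonem s) _ _) x Ax).
      by rewrite uonem_gt0.
    by rewrite uval_onem; exact: le_trans rr3.
  move=> s s' ss' s'1 sr; rewrite (splitr e).
  apply: (emetric_tri dm (emetric_sym dm (near1 s' s'1 _))).
    by have ss : uval s <= uval s' := ss'; lra.
  by apply: near1 => //; exact: le_lt_trans s'1.
Qed.

End equicadlag_families.

(** * The spaces of the theorem *)

Section skorohod_spaces.
Local Open Scope ring_scope.
Context {R : realType}.
Local Notation I := (unit_itv R).
Local Notation D := (D R).
Local Notation DD := (DD R).

Lemma D_cadlag (x : D) : cadlag x.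
Proof. by case: x. Qed.

Lemma DD_cadlag (x : DD) : cadlag x.
Proof. by case: x. Qed.

Lemma emetric_dJ1 : emetric (@dJ1 R).
Proof.
exact: (emetric_comp (@Dfun R) (emetric_skorohod group_length_log_norm emetric_dR)).
Qed.

Lemma metrizes_dJ1 : metrizes (@dJ1 R).
Proof. by apply: metric_open_metrizes emetric_dJ1 _. Qed.

Lemma seq_complete_dJ1 : seq_complete (@dJ1 R).
Proof.
apply: (seq_complete_skorohod emetric_dR metrizes_dR seq_complete_dR D_cadlag).
by move=> y yc; exists (MkD yc).
Qed.

Lemma emetric_dDD : emetric (@dDD R).
Proof.
exact: (emetric_comp (@DDfun R) (emetric_skorohod group_length_disp emetric_dJ1)).
Qed.

Lemma metrizes_dDD : metrizes (@dDD R).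
Proof. by apply: metric_open_metrizes emetric_dDD _. Qed.

(** The complete distance that refines [dDD]. *)
Definition dDD0 (x y : DD) : \bar R := skorohod (@log_norm R) (@dJ1 R) x y.

Lemma emetric_dDD0 : emetric dDD0.
Proof.
exact: (emetric_comp (@DDfun R) (emetric_skorohod group_length_log_norm emetric_dJ1)).
Qed.

Lemma seq_complete_dDD0 : seq_complete dDD0.
Proof.
apply: (seq_complete_skorohod emetric_dJ1 metrizes_dJ1 seq_complete_dJ1 DD_cadlag).
by move=> y yc; exists (MkDD yc).
Qed.

Lemma dDD0_dDD (e : R) : 0 < e -> exists2 r : R, 0 < r &
  forall x y, (dDD0 x y <= r%:E)%E -> (dDD x y <= e%:E)%E.
Proof.
move=> e0; have [r r0 rP] := log_norm_disp e0.
exists (Num.min r e / 2); first by rewrite divr_gt0// lt_min r0.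
have m0 : 0 < Num.min r e by rewrite lt_min r0.
move=> x y xy; have {}xy : (dDD0 x y < (Num.min r e)%:E)%E.
  by apply: le_lte_fin xy _; lra.
have [l [Ll ll lxy]] := skorohod_lt xy.
apply: (skorohod_le Ll).
  by apply: rP => //; apply: le_trans ll _; rewrite lee_fin ge_min lexx.
by move=> t; apply: le_trans (lxy t) _; rewrite lee_fin ge_min lexx orbT.
Qed.

Lemma near_small_moduli (S : topologicalType) (d : S -> S -> \bar R)
    (N : (I -> I) -> \bar R) (e : R) : emetric d -> metrizes d ->
  (forall e : R, 0 < e -> exists2 r : R, 0 < r & forall l, @Lambda R l ->
    (N l <= r%:E)%E -> (disp l <= e%:E)%E) -> 0 < e ->
  near_small (@cadlag R S) (skorohod N d)
    (fun r x => w2_le d e r x /\ left_le d e r x /\ right_le d e r x).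
Proof.
move=> dm dS Nd e0; apply: near_small_and; last apply: near_small_and.
- exact: near_small_w2.
- exact: near_small_left.
- exact: near_small_right.
Qed.

Lemma near_small_values (P : R -> D -> Prop) : near_small setT (@dJ1 R) P ->
  near_small setT (@dDD R) (fun r x => forall t, P r (DDfun x t)).
Proof.
move=> /(near_small_pointwise emetric_dJ1 metrizes_dJ1 (@disp R)).
exact: (near_small_comp (f := @DDfun R) DD_cadlag).
Qed.

Lemma relatively_compact_moduli (A : set DD) : compact (closure A) ->
  [/\ (nnsup A (fun x => DDnorm x) < +oo)%E,
      equicadlag (@dR R) (A `*` setT) (fun p : DD * I => Dfun (DDfun p.1 p.2)) &
      equicadlag (@dJ1 R) A (@DDfun R)].
Proof.
move=> cA; have AcA := @subset_closure _ A; split.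
- have bJ : near_small setT (@dJ1 R) (fun r (y : D) => forall s, bounded_by r (y s)).
    exact: (near_small_comp (f := @Dfun R) D_cadlag (near_small_pointwise emetric_dR
      metrizes_dR (@log_norm R) near_small_bounded)).
  have [r r0 rP] := near_small_compact metrizes_dDD cA (near_small_values bJ).
  apply: (@le_lt_trans _ _ (r^-1)%:E); last exact: ltry.
  apply/nnsup_le; first by rewrite lee_fin invr_ge0 ltW.
  move=> x /AcA Ax; apply/ge_sup_range => t; apply/ge_sup_range => s.
  by rewrite lee_fin; exact: rP.
- move=> e e0.
  have mJ := near_small_comp (f := @Dfun R) D_cadlag
    (near_small_moduli emetric_dR metrizes_dR log_norm_disp e0).
  have [r r0 rP] := near_small_compact metrizes_dDD cA (near_small_values mJ).
  exists r => // -[x t] [/= /AcA Ax _].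
  by have [w [l r']] := rP x Ax r r0 (lexx r) t.
- move=> e e0.
  have mD := near_small_comp (f := @DDfun R) DD_cadlag
    (near_small_moduli emetric_dJ1 metrizes_dJ1 disp_disp e0).
  have [r r0 rP] := near_small_compact metrizes_dDD cA mD.
  by exists r => // x /AcA Ax; have [w [l r']] := rP x Ax r r0 (lexx r).
Qed.

Lemma moduli_relatively_compact (A : set DD) :
  (nnsup A (fun x => DDnorm x) < +oo)%E ->
  equicadlag (@dR R) (A `*` setT) (fun p : DD * I => Dfun (DDfun p.1 p.2)) ->
  equicadlag (@dJ1 R) A (@DDfun R) -> compact (closure A).
Proof.
move=> /lte_fin_bound[M M0 AM] Ain Aout.
pose K : set D := [set y | exists2 p : DD * I, A p.1 & y = DDfun p.1 p.2].
have Kb : tbounded (@dJ1 R) K.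
  apply: (tbounded_skorohod emetric_dR metrizes_dR D_cadlag (@tbounded_itv R M)).
    move=> _ s [[x t] /= Ax ->]; rewrite /= in_itv /= -ler_norml -lee_fin.
    have M0' : (0 <= M%:E)%E by rewrite lee_fin.
    have := (nnsup_le _ _ M0').1 AM x Ax.
    by move=> /ge_sup_range/(_ t)/ge_sup_range/(_ s).
  move=> e /Ain[r r0 rP]; exists r => // _ [[x t] /= Ax ->].
  exact: (rP (x, t)).
have Ab : tbounded dDD0 A.
  apply: (tbounded_skorohod emetric_dJ1 metrizes_dJ1 DD_cadlag Kb) => //.
  by move=> x t Ax; exists (x, t).
apply: (compact_closure_ultra emetric_dDD metrizes_dDD) => F FU FA.
have [p pP] := tbounded_cvg emetric_dDD0 seq_complete_dDD0 Ab FU FA.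
exists p => U /metrizes_dDD[e e0 eU]; have [r r0 rP] := dDD0_dDD e0.
by apply: filterS (pP r r0) => y /rP/eU.
Qed.

End skorohod_spaces.

Unset Implicit Arguments.
Set Strict Implicit.
Local Open Scope ereal_scope.

Theorem theorem2p10 (R : realType) (A : set (DD R)) :
  compact (closure A) <->
  [/\ (* (i) *) nnsup A (fun x => DDnorm x) < +oo,
   (* (ii') *)
   [/\ nnsup A (fun x => nnsup setT (fun t => w2 (x t) (uval d)))
         @[d --> (@u0 R)^'] --> 0,
       nnsup A (fun x => nnsup setT (fun t => `|x t d - x t u0|%:E))
         @[d --> (@u0 R)^'] --> 0 &
       nnsup A (fun x => nnsup setT (fun t =>
           `|left_lim (x t) u1 - x t (uonem d)|%:E))
         @[d --> (@u0 R)^'] --> 0] &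
   (* (iii') *)
   [/\ nnsup A (fun x => w2DD x (uval d)) @[d --> (@u0 R)^'] --> 0,
       nnsup A (fun x => dJ1 (x d) (x u0)) @[d --> (@u0 R)^'] --> 0 &
       nnsup A (fun x => dJ1 (left_lim x u1) (x (uonem d)))
         @[d --> (@u0 R)^'] --> 0]].
Proof.
have inner := equicadlagP emetric_dR metrizes_dR (A `*` setT)
  (f := fun p : DD R * unit_itv R => Dfun (DDfun p.1 p.2))
  (fun p => D_cadlag (DDfun p.1 p.2)).
have outer := equicadlagP emetric_dJ1 metrizes_dJ1 A (f := @DDfun R) (@DD_cadlag R).
rewrite (cvg_nnsup_setX A (fun d x t => w2 (x t) (uval d))).
rewrite (cvg_nnsup_setX A (fun d x t => `|x t d - x t u0|%:E)).
rewrite (cvg_nnsup_setX A (fun d x t => `|left_lim (x t) u1 - x t (uonem d)|%:E)).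
split=> [/relatively_compact_moduli[bA /inner iA /outer oA]|[bA /inner iA /outer oA]].
  by split.
exact: moduli_relatively_compact.
Qed.
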